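(* Let $n\ge 2$ be an integer and consider the planar system with real coefficients $$\dot x=y+a_{30}x^3+a_{21}x^2y+a_{12}xy^2+a_{03}y^3+\sum_{i+j=2n+3}a_{ij}x^iy^j,\qquad \dot y=-2x^3 .$$ The origin is an analytic center if and only if $$a_{30}=a_{12}=a_{2n+3,0}=a_{2n+1,2}=\cdots=a_{3,2n}=a_{1,2n+2}=0,$$ i.e. if and only if $a_{30}=a_{12}=0$ and $a_{2n+3-2k,\,2k}=0$ for all $k=0,1,\dots,n+1$.
   Context: The origin of a planar real analytic system is called an analytic center if it is a center and the system has a (nonconstant) analytic first integral in a neighborhood of the origin. *)

(* Defs.v *)
From mathcomp Require Import all_boot all_order all_algebra.
From mathcomp Require Import all_classical all_reals all_analysis.

Set Implicit Arguments.
Unset Strict Implicit.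
Unset Printing Implicit Defensive.

Import Order.TTheory GRing.Theory Num.Theory.
Import numFieldNormedType.Exports.

Local Open Scope classical_set_scope.
Local Open Scope ring_scope.

Section AnalyticFunctions.
Context {R : realType}.

Definition square_sum (u : nat -> nat -> R) : R^nat :=
  fun N => \sum_(i < N) \sum_(j < N) u i j.

(* Square partial sums of nonnegative terms are cofinal among all finite
   partial sums, so the first clause is absolute summability of the family
   [u i j]; the second one then gives its unconditional sum. *)
Definition abs_sums_to (u : nat -> nat -> R) (l : R) : Prop :=
  cvgn (square_sum (fun i j => `|u i j|)) /\ square_sum u @ \oo --> l.

Definition analytic_at (H : R * R -> R) (p : R * R) : Prop :=
  exists (c : nat -> nat -> R) (r : R), 0 < r /\
    forall h k : R, `|h| < r -> `|k| < r ->
      abs_sums_to (fun i j => c i j * h ^+ i * k ^+ j) (H (p.1 + h, p.2 + k)).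

End AnalyticFunctions.

Section PlanarSystems.
Context {R : realType}.
Variable X : R * R -> R * R.

Definition solution (phi : R -> R * R) : Prop :=
  forall t : R, is_derive t (1 : R) phi (X (phi t)).

Definition periodic_solution (phi : R -> R * R) : Prop :=
  [/\ solution phi,
      exists T : R, 0 < T /\ forall t, phi (t + T) = phi t
    & exists t, phi t <> phi 0].

(* A singular point is a center when it has an open neighborhood consisting,
   besides the point itself, of periodic orbits. *)
Definition center : Prop :=
  X (0, 0) = (0, 0) /\
  exists U : set (R * R), [/\ open U, U (0, 0) &
    forall p, U p -> p <> (0, 0) ->
      exists phi, [/\ periodic_solution phi, phi 0 = p & forall t, U (phi t)]].

(* Nonconstancy is required on every neighborhood of the origin, which for
   analytic functions amounts to nonconstancy on one connected neighborhood. *)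
Definition analytic_first_integral (H : R * R -> R) : Prop :=
  [/\ \forall p \near ((0, 0) : R * R), analytic_at H p,
      \forall p \near ((0, 0) : R * R),
        (X p).1 * 'D_((1, 0) : R * R) H p
          + (X p).2 * 'D_((0, 1) : R * R) H p = 0
    & ~ \forall p \near ((0, 0) : R * R), H p = H (0, 0)].

Definition analytic_center : Prop :=
  center /\ exists H, analytic_first_integral H.

End PlanarSystems.

Definition nilpotent_system {R : realType} (n : nat) (a : nat -> nat -> R)
    (p : R * R) : R * R :=
  let: (x, y) := p in
  (y + a 3%N 0%N * x ^+ 3 + a 2%N 1%N * x ^+ 2 * y + a 1%N 2%N * x * y ^+ 2
     + a 0%N 3%N * y ^+ 3
     + \sum_(i < (2 * n + 3).+1)
         a i (2 * n + 3 - i)%N * x ^+ i * y ^+ (2 * n + 3 - i),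
   - 2%:R * x ^+ 3).

(* Main.v *)
(* The system is reversible for both [(x, y, t) -> (- x, y, - t)] and
   [(x, y, t) -> (x, - y, - t)] exactly when every term of the first component
   is even in [x] and odd in [y]; the coefficients in the theorem are those of
   the terms that are odd in [x] and even in [y].

   Necessity only uses the first integral.  Give [x ^+ i * y ^+ j] the weight
   [i + 2 * j].  The lowest form of the Taylor series of a first integral is
   constant along the flow of [(y, - 2 * x ^+ 3)], so it is a multiple of a power
   of [y ^+ 2 + x ^+ 4]: up to sign, all its nonzero coefficients are positive and
   even in both variables.  The nonreversible terms have pairwise distinct
   weights.  If one of lowest weight [w] had a nonzero coefficient, the
   coefficients of the series that are odd in both variables would vanish below
   some weight, and there they would satisfy a two-term recurrence with a source
   of constant sign; positivity propagates along it up to its last equation, which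
   cannot then hold.

   Conversely, in the variables [u = x ^+ 2], [v = y ^+ 2] a reversible system
   becomes regular at the origin, so it has an analytic first integral
   [H = y ^+ 2 + x ^+ 4 * (1 + o(1))], whose sublevel sets trap the orbits.  A
   trapped orbit meets both axes, and reflecting it about the two meeting instants
   shows that it is periodic. *)
Require Import Defs.
From HB Require Import structures.
From mathcomp Require Import all_boot all_order all_algebra.
From mathcomp Require Import all_classical all_reals all_analysis.
From mathcomp Require Import zify ring lra.
Import Order.TTheory GRing.Theory Num.Theory.
Import numFieldNormedType.Exports.
Local Open Scope ring_scope.
Set Implicit Arguments.
Unset Strict Implicit.
Unset Printing Implicit Defensive.
Local Open Scope classical_set_scope.

(** * Formal obstructions *)

(** All terms of the field have odd total degree. Hence, at positions even in both variables, the
    equation of a first integral sees the coefficients odd in both variables through the reversible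
    terms, and those even in both through the nonreversible ones. The former can start only where
    the lowest nonreversible term meets the leading form, and there the sign of the source is known.
    A single term acts at that place: the nonreversible weights are 3 and 5 in the cubic part and
    the odd numbers from 2n+3 to 4n+5 in the other, whereas for n = 1 the terms x y^2 and x^5 would
    share the weight 5. In the converse, the field is only locally Lipschitz while periodic orbits
    are required on the whole time line. The field is therefore precomposed with the truncation of
    both coordinates to [-1, 1]. The result is bounded and globally Lipschitz, so Picard's iteration
    converges for all times; the truncation is odd, so both reflections survive; and trapped orbits
    never see it. *)

Section CoefficientArrays.
Context {R : realFieldType}.
Implicit Types c e : nat -> nat -> R.

Definition dx c : nat -> nat -> R := fun i j => i.+1%:R * c i.+1 j.
Definition dy c : nat -> nat -> R := fun i j => j.+1%:R * c i j.+1.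

(* The coefficients of [x ^+ k * y ^+ l * f] when [c] are those of [f]. *)
Definition shift_coef k l c : nat -> nat -> R :=
  fun i j => if (k <= i)%N && (l <= j)%N then c (i - k)%N (j - l)%N else 0.

(* The coefficients of the derivative of [\sum_(i, j) c i j * x ^+ i * y ^+ j]
   along [(\sum_(k, l < D) e k l * x ^+ k * y ^+ l, - 2 * x ^+ 3)]. *)
Definition lie_coef D e c : nat -> nat -> R := fun i j =>
  \sum_(k < D) \sum_(l < D) e k l * shift_coef k l (dx c) i j
  - 2 * shift_coef 3 0 (dy c) i j.

End CoefficientArrays.

(* The weight [i + 2 * j] makes [y ^+ 2 + x ^+ 4] quasi-homogeneous; the term
   [x ^+ k * y ^+ l] of the first component then raises weights by
   [k + 2 * l - 1]. *)
Section Obstruction.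
Context {R : realFieldType}.
Variables (D : nat) (e c : nat -> nat -> R).
Hypothesis D1 : (1 < D)%N.
Hypothesis e01 : e 0%N 1%N = 1.
Hypothesis e_odd : forall k l, e k l != 0 -> odd (k + l).
Hypothesis e_weight : forall k l,
  e k l != 0 -> (k, l) != (0, 1)%N -> (3 <= k + 2 * l)%N.
Hypothesis e_inj : forall k l k' l', odd k -> odd k' -> e k l != 0 ->
  e k' l' != 0 -> (k + 2 * l = k' + 2 * l')%N -> k = k' /\ l = l'.
Hypothesis lie_c : forall i j, lie_coef D e c i j = 0.

(** The perturbation: by [e_weight] its terms raise weights by at least 2, while [y] raises them by
    1. *)
Let S i j := \sum_(p : 'I_D * 'I_D | (val p.1, val p.2) != (0, 1)%N)
  e p.1 p.2 * shift_coef p.1 p.2 (dx c) i j.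

Let eqS i j : shift_coef 0 1 (dx c) i j + S i j =
  2 * shift_coef 3 0 (dy c) i j.
Proof.
have /eqP := lie_c i j; rewrite /lie_coef subr_eq0 => /eqP <-.
rewrite pair_big /= (bigD1 (Ordinal (ltnW D1), Ordinal D1)) //= e01 mul1r.
by congr (_ + _); apply: eq_bigl => -[[k hk] [l hl]] /=.
Qed.

(** Up to [S], an equation links only [c s t.+1] and [c (s + 4) t.-1]: within one weight the
    coefficients form chains along which [s] drops by 4 while [t] grows by 2. The default 0 occurs
    at the head of a chain. *)
Let eqSr s t : S (s + 3) t = 2 * (t.+1%:R * c s t.+1) -
   (if t is t'.+1 then (s + 4)%:R * c (s + 4)%N t' else 0).
Proof.
have := eqS (s + 3) t; rewrite /shift_coef /dx /dy.
rewrite leq_addl /= subn0 addnK; case: t => [|t] /=.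
  by rewrite add0r subr0.
by rewrite !subn0 subn1 /= -addnS => <-; rewrite addrC addKr.
Qed.

(** The equation left over at the foot of a chain: below degree 3 in [x], the term [- 2 * x ^+ 3] of
    the field contributes nothing. *)
Let S_end s t : (s < 3)%N -> s.+1%:R * c s.+1 t + S s t.+1 = 0.
Proof.
move=> s3; have := eqS s t.+1; rewrite /shift_coef /dx /dy.
rewrite [(3 <= s)%N]leqNgt s3 /= mulr0.
by rewrite subn0 subn1.
Qed.

(** * The lowest quasi-homogeneous form of a first integral *)

Section LeadingForm.
Variable d0 : nat.
Hypothesis d0_gt0 : (0 < d0)%N.
Hypothesis c_low : forall i j, (0 < i + 2 * j < d0)%N -> c i j = 0.
Hypothesis c_top : exists i j, (i + 2 * j = d0)%N /\ c i j != 0.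

(** Perturbing terms read coefficients of positive weight below [d0]. *)
Let S_top i j : (i + 2 * j = d0.+1)%N -> S i j = 0.
Proof.
move=> hij; rewrite /S big1 // => -[[k hk] [l hl]] /= hkl.
have [->|e0] := eqVneq (e k l) 0; first by rewrite mul0r.
have := e_weight e0 hkl; rewrite /shift_coef => h3.
case: ifP => [/andP[ki lj]|]; last by rewrite mulr0.
by rewrite /dx c_low ?mulr0 //; lia.
Qed.

Let c_step s t : (s + 2 * t.+1 = d0)%N -> 2 * (t.+1%:R * c s t.+1) =
  if t is t'.+1 then (s + 4)%:R * c (s + 4)%N t' else 0.
Proof.
move=> hst; apply/eqP; rewrite -subr_eq0 -eqSr S_top //; lia.
Qed.

Let c_stepS s t : (s + 2 * t.+2 = d0)%N ->
  c s t.+2 = (s + 4)%:R / (2 * t.+2%:R) * c (s + 4)%N t.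
Proof.
move/c_step => /= h; have t0 : (2 * t.+2%:R : R) != 0.
  by rewrite mulf_neq0 ?pnatr_eq0.
apply: (mulfI t0).
by rewrite [RHS]mulrA [_ * (_ / _)]mulrC divfK // -h mulrA.
Qed.

(** Chains through odd [t] are headed by some [c s 1], which the head equation annihilates. *)
Let c_odd t : odd t -> forall s, (s + 2 * t = d0)%N -> c s t = 0.
Proof.
elim/ltn_ind: t => -[//|[|t]] IH ht s hst.
  have := c_step hst; rewrite mul1r => /eqP.
  by rewrite mulf_eq0 pnatr_eq0 /= => /eqP.
by rewrite c_stepS // IH ?mulr0 //; lia.
Qed.

(** Every coefficient of the leading form is either zero or a positive multiple of the coefficient
    of the pure power of [x]. *)
Lemma leading_axis_neq0 : c d0 0%N != 0.
Proof.
have [s0 [t0 [h0]]] := c_top; apply: contra => /eqP c0.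
suff: forall t s, (s + 2 * t = d0)%N -> c s t = 0 by move=> ->.
elim/ltn_ind => -[|[|t]] IH s hst.
- by rewrite -c0 -hst addn0.
- by rewrite c_odd.
by rewrite c_stepS // IH ?mulr0 //; lia.
Qed.

Hypothesis c_pos : 0 < c d0 0%N.

Let leading_gt0 t : ~~ odd t -> forall s, (s + 2 * t = d0)%N -> 0 < c s t.
Proof.
elim/ltn_ind: t => -[|[//|t]] IH ht s hst.
  by move: hst; rewrite muln0 addn0 => ->.
rewrite c_stepS //; apply: mulr_gt0.
  by apply: divr_gt0; [rewrite ltr0n; lia|rewrite mulr_gt0 ?ltr0n].
by apply: IH; lia.
Qed.

Let leading_ge0 s t : (s + 2 * t = d0)%N -> 0 <= c s t.
Proof.
move=> hst; case: (boolP (odd t)) => ht; first by rewrite c_odd.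
by apply/ltW/leading_gt0.
Qed.

(** Otherwise the chain of positive coefficients ends at an exponent 1, 2 or 3 of [x], where [S_end]
    forces the last of them to vanish. *)
Let d0_mod4 : (d0 %% 4 = 0)%N.
Proof.
case E : (d0 %% 4)%N => [//|s]; exfalso.
have hs : (s.+1 + 2 * (2 * (d0 %/ 4)) = d0)%N by lia.
have c0 : 0 < c s.+1 (2 * (d0 %/ 4))%N by apply: leading_gt0 => //; lia.
have s3 : (s < 3)%N by lia.
have /eqP := S_end (2 * (d0 %/ 4))%N s3.
by rewrite S_top ?addr0 ?mulf_eq0 ?pnatr_eq0 ?gt_eqF //; lia.
Qed.

(** * The lowest coefficients odd in both variables *)

Section LowestReversal.
Variables k0 l0 : nat.
Hypothesis k0D : (k0 < D)%N.
Hypothesis l0D : (l0 < D)%N.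
Hypothesis k0_odd : odd k0.
Hypothesis e0_neq0 : e k0 l0 != 0.
Hypothesis e_min : forall k l, (k < D)%N -> (l < D)%N -> odd k ->
  e k l != 0 -> (k0 + 2 * l0 <= k + 2 * l)%N.

Let l0_even : ~~ odd l0.
Proof. by have := e_odd e0_neq0; rewrite oddD k0_odd; case: odd. Qed.

(** For odd [k], minimality of the weight of [(k0, l0)] makes the term read the series below its
    leading weight. For even [k], it reads a coefficient odd in both variables and of weight less
    than [W]. *)
Let S_oo W i j : (W < d0 + (k0 + 2 * l0) - 2)%N ->
  (forall W' s t, (W' < W)%N -> odd s -> odd t -> (s + 2 * t = W')%N ->
     c s t = 0) ->
  ~~ odd i -> ~~ odd j -> (i + 2 * j = W.+1)%N -> S i j = 0.
Proof.
move=> hW IH hi hj hij; rewrite /S big1 // => -[[k hk] [l hl]] /= hkl.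
have [->|e0] := eqVneq (e k l) 0; first by rewrite mul0r.
rewrite /shift_coef; case: ifP => [/andP[ki lj]|]; last by rewrite mulr0.
have h3 := e_weight e0 hkl; have ho := e_odd e0.
case: (boolP (odd k)) => kodd.
  have := e_min hk hl kodd e0 => hw.
  by rewrite /dx c_low ?mulr0 //; lia.
by rewrite /dx (IH ((i - k).+1 + 2 * (j - l))%N) ?mulr0 //; lia.
Qed.

Let oo_zero W : (W < d0 + (k0 + 2 * l0) - 2)%N ->
  forall s t, odd s -> odd t -> (s + 2 * t = W)%N -> c s t = 0.
Proof.
elim/ltn_ind: W => W IHW hW s t; move: s.
have {}IHW : forall W' s t, (W' < W)%N -> odd s -> odd t ->
  (s + 2 * t = W')%N -> c s t = 0.
  by move=> W' s' t' h *; apply: (IHW W') => //; lia.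
elim/ltn_ind: t => -[//|t] IH s hs ht hst.
have S0 : S (s + 3) t = 0 by apply: (S_oo hW) => //; lia.
have := eqSr s t; rewrite S0 {S0}.
case: t ht hst IH => [|[//|t]] ht hst IH.
  by rewrite subr0 => /esym/eqP; rewrite !mulf_eq0 !pnatr_eq0 /= => /eqP.
have c0 : c (s + 4)%N t.+1 = 0 by apply: IH; lia.
rewrite c0 mulr0 subr0.
by move=> /esym/eqP; rewrite !mulf_eq0 !pnatr_eq0 /= => /eqP.
Qed.

(** The lowest nonreversible term carries the leading form to weight [m.+1]; the equations of that
    weight govern the coefficients of weight [m]. *)
Let m := (d0 + (k0 + 2 * l0) - 2)%N.

Let S_line i j : ~~ odd i -> ~~ odd j -> (i + 2 * j = m.+1)%N ->
  S i j = e k0 l0 * shift_coef k0 l0 (dx c) i j.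
Proof.
move=> hi hj hij.
have kl01 : (k0, l0) != (0, 1)%N by case: (k0) k0_odd.
have := e_weight e0_neq0 kl01 => h03.
rewrite /S (bigD1 (Ordinal k0D, Ordinal l0D)) //= big1 ?addr0 //.
move=> -[[k hk] [l hl]] /= /andP[hkl]; rewrite xpair_eqE -!val_eqE /= => hne.
have [->|e0] := eqVneq (e k l) 0; first by rewrite mul0r.
rewrite /shift_coef; case: ifP => [/andP[ki lj]|]; last by rewrite mulr0.
have h3 := e_weight e0 hkl; have ho := e_odd e0.
case: (boolP (odd k)) => kodd; last first.
  by rewrite /dx (@oo_zero ((i - k).+1 + 2 * (j - l))%N) ?mulr0 //; rewrite /m in hij; lia.
have hw := e_min hk hl kodd e0.
have hw' : (k0 + 2 * l0 != k + 2 * l)%N.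
  apply/eqP => /(e_inj k0_odd kodd e0_neq0 e0)[ek el].
  by rewrite ek el !eqxx in hne.
by rewrite /dx c_low ?mulr0 //; rewrite /m in hij; lia.
Qed.

Let T_ge0 i j : (i + 2 * j = m.+1)%N -> 0 <= shift_coef k0 l0 (dx c) i j.
Proof.
move=> hij; rewrite /shift_coef; case: ifP => // /andP[ki lj].
by rewrite /dx mulr_ge0 ?ler0n // leading_ge0 //; rewrite /m in hij; lia.
Qed.

(** Multiplication by [e k0 l0] turns the source into a square times a nonnegative number, whatever
    the sign of [e k0 l0]. *)
Let y s t := e k0 l0 * c s t.

Let y_step s t : odd s -> odd t.+1 -> (s + 2 * t.+1 = m)%N ->
  2 * t.+1%:R * y s t.+1 =
  (if t is t'.+1 then (s + 4)%:R * y (s + 4)%N t' else 0)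
  + e k0 l0 ^+ 2 * shift_coef k0 l0 (dx c) (s + 3) t.
Proof.
move=> hs ht hst.
have := eqSr s t; rewrite S_line; try lia; move=> h.
rewrite expr2 -[_ * _ * shift_coef _ _ _ _ _]mulrA h /y.
by case: t {h ht hst} => [|t]; ring.
Qed.

Let y_ge0 t : forall s, odd s -> odd t -> (s + 2 * t = m)%N -> 0 <= y s t.
Proof.
elim/ltn_ind: t => -[//|t] IH s hs ht hst.
have /esym := y_step hs ht hst.
have h1 : 0 < 2 * t.+1%:R :> R by rewrite mulr_gt0 ?ltr0n.
have h2 : 0 <= e k0 l0 ^+ 2 * shift_coef k0 l0 (dx c) (s + 3) t.
  by rewrite mulr_ge0 ?sqr_ge0 // T_ge0 //; lia.
rewrite -(pmulr_rge0 _ h1) => <-; rewrite addr_ge0 //.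
case: t ht hst IH {h1 h2} => // -[//|t] ht hst IH.
by rewrite mulr_ge0 ?ler0n // IH //; lia.
Qed.

(** The source is strictly positive in the equation for [y s l0.+1], where [x ^+ k0 * y ^+ l0] meets
    the pure power with coefficient [c d0 0]. Further down the chain only nonnegative quantities are
    added. *)
Let y_gt0 t : (l0 < t)%N ->
  forall s, odd s -> odd t -> (s + 2 * t = m)%N -> 0 < y s t.
Proof.
elim/ltn_ind: t => -[//|t] IH lt0 s hs ht hst.
have /esym := y_step hs ht hst.
have h1 : 0 < 2 * t.+1%:R :> R by rewrite mulr_gt0 ?ltr0n.
have h2 : 0 <= e k0 l0 ^+ 2 * shift_coef k0 l0 (dx c) (s + 3) t.
  by rewrite mulr_ge0 ?sqr_ge0 // T_ge0 //; lia.
have h3 : 0 <= if t is t'.+1 then (s + 4)%:R * y (s + 4) t' else 0.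
  case: t ht hst {IH lt0 h1 h2} => // -[//|t] ht hst.
  by rewrite mulr_ge0 ?ler0n // y_ge0 //; lia.
rewrite -(pmulr_rgt0 _ h1) => <-.
have [tl|tl] := eqVneq t l0.
  apply: ltr_wpDl => //; rewrite mulr_gt0 ?exprn_even_gt0 //.
  rewrite /shift_coef tl leqnn andbT.
  have -> : (k0 <= s + 3)%N by rewrite /m in hst; lia.
  rewrite subnn /dx mulr_gt0 ?ltr0n //.
  by have -> : ((s + 3 - k0).+1 = d0)%N by rewrite /m in hst; lia.
apply: ltr_pwDl => //.
case: t ht hst IH lt0 tl {h1 h2 h3} => [|[//|t]] ht hst IH lt0 tl; first lia.
by rewrite mulr_gt0 ?ltr0n ?addn4 // -addn4 IH //; lia.
Qed.

Lemma lowest_reversal_absurd : False.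
Proof.
(* The pure power first acts at [(d0 + k0 - 4, l0 + 1)]; [r] moves by [(- 4, + 2)] lead from there
   to the foot [(s, t)] of the chain. As 4 divides [d0] and [k0] is odd, [s] is 1 or 3. *)
pose r := ((d0 + k0 - 4) %/ 4)%N; pose t := (l0 + 1 + 2 * r)%N.
pose s := ((d0 + k0 - 4) %% 4)%N.
have d04 : (4 <= d0)%N by have := d0_mod4; lia.
have hs : odd s by rewrite /s; have := d0_mod4; lia.
have hst : (s + 2 * t = m)%N by rewrite /s /t /r /m; lia.
have ht : odd t by rewrite /t; lia.
have y0 : 0 < y s t by apply: y_gt0 => //; rewrite /t; lia.
case E : s hs hst y0 => [//|s'] hs hst y0.
have s3 : (s' < 3)%N by have := ltn_pmod (d0 + k0 - 4) (isT : (0 < 4)%N); rewrite -/s E; lia.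
have := S_end t s3; rewrite S_line; try lia.
move/(congr1 ( *%R (e k0 l0))); rewrite mulr0 mulrDr mulrCA -/(y _ _) mulrA -expr2.
have : 0 < s'.+1%:R * y s'.+1 t by rewrite mulr_gt0 ?ltr0n.
have : 0 <= e k0 l0 ^+ 2 * shift_coef k0 l0 (dx c) s' t.+1.
  by rewrite mulr_ge0 ?sqr_ge0 // T_ge0 //; lia.
by lra.
Qed.

End LowestReversal.
End LeadingForm.
End Obstruction.

Lemma lie_coefN {R : realFieldType} D (e c : nat -> nat -> R) i j :
  lie_coef D e (fun i j => - c i j) i j = - lie_coef D e c i j.
Proof.
have shiftN k l (u : nat -> nat -> R) (v : nat -> nat -> R) :
    (forall s t, v s t = - u s t) ->
    shift_coef k l v i j = - shift_coef k l u i j.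
  by move=> uv; rewrite /shift_coef; case: ifP => _; rewrite ?uv ?oppr0.
rewrite /lie_coef (shiftN _ _ (dy c)) => [|s t]; last by rewrite /dy mulrN.
rewrite mulrN opprK opprD opprK; congr (_ + _).
rewrite -sumrN; apply: eq_bigr => k _; rewrite -sumrN; apply: eq_bigr => l _.
by rewrite (shiftN _ _ (dx c)) ?mulrN // => s t; rewrite /dx mulrN.
Qed.

(** The obstruction asks for a positive leading coefficient; since the equations are linear in [c],
    it applies to [c] or to [- c]. *)
Lemma formal_first_integral_even {R : realFieldType} D (e c : nat -> nat -> R) :
  (1 < D)%N -> e 0%N 1%N = 1 ->
  (forall k l, e k l != 0 -> odd (k + l)) ->
  (forall k l, e k l != 0 -> (k, l) != (0, 1)%N -> (3 <= k + 2 * l)%N) ->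
  (forall k l k' l', odd k -> odd k' -> e k l != 0 -> e k' l' != 0 ->
    (k + 2 * l = k' + 2 * l')%N -> k = k' /\ l = l') ->
  (forall i j, lie_coef D e c i j = 0) ->
  (exists i j, (0 < i + 2 * j)%N /\ c i j != 0) ->
  forall k l, (k < D)%N -> (l < D)%N -> odd k -> e k l = 0.
Proof.
move=> D1 e01 e_odd e_weight e_inj lie_c [i1 [j1 [ij1 cij1]]] k1 l1 k1D l1D k1odd.
apply/eqP; apply: contraT => e1.
pose P d := (0 < d)%N && [exists i : 'I_d.+1, [exists j : 'I_d.+1,
  (i + 2 * j == d)%N && (c i j != 0)]].
have Pij i j : (0 < i + 2 * j)%N -> c i j != 0 -> P (i + 2 * j)%N.
  move=> ij cij; rewrite /P ij /=.
  have hi : (i < (i + 2 * j).+1)%N by lia.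
  have hj : (j < (i + 2 * j).+1)%N by lia.
  apply/existsP; exists (Ordinal hi); apply/existsP; exists (Ordinal hj).
  by rewrite /= eqxx.
have exP : exists d, P d by exists (i1 + 2 * j1)%N; exact: Pij.
case: (ex_minnP exP) => d0 /andP[d0_gt0 /existsP[i0 /existsP[j0]]].
move=> /andP[/eqP ij0 cij0] d0_min.
have c_low i j : (0 < i + 2 * j < d0)%N -> c i j = 0.
  move=> /andP[ij ijd]; apply/eqP; apply: contraLR ijd => cij.
  by rewrite -leqNgt d0_min // Pij.
pose Q (p : 'I_D * 'I_D) := odd p.1 && (e p.1 p.2 != 0).
have Q1 : Q (Ordinal k1D, Ordinal l1D) by rewrite /Q /= k1odd.
pose p0 := [arg min_(p < (Ordinal k1D, Ordinal l1D) | Q p) (p.1 + 2 * p.2)%N].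
have [/andP[p0_odd ep0] p0_min] : Q p0 /\
    forall p, Q p -> (p0.1 + 2 * p0.2 <= p.1 + 2 * p.2)%N.
  by rewrite /p0; case: arg_minnP.
have e_min k l : (k < D)%N -> (l < D)%N -> odd k -> e k l != 0 ->
    (p0.1 + 2 * p0.2 <= k + 2 * l)%N.
  by move=> kD lD ko ekl; apply: (p0_min (Ordinal kD, Ordinal lD)); apply/andP.
have c_top : exists i j, (i + 2 * j = d0)%N /\ c i j != 0.
  by exists i0, j0.
have := leading_axis_neq0 D1 e01 e_weight lie_c d0_gt0 c_low c_top.
have absurd := lowest_reversal_absurd D1 e01 e_odd e_weight e_inj.
case: ltgtP => // c0 _; last first.
  by case: (absurd _ lie_c d0 d0_gt0 c_low c0 p0.1 p0.2).
case: (absurd (fun i j => - c i j) _ d0 d0_gt0 _ _ p0.1 p0.2) => //.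
- by move=> i j; rewrite lie_coefN lie_c oppr0.
- by move=> i j /c_low ->; rewrite oppr0.
- by rewrite oppr_gt0.
Qed.

(** * Unordered sums *)

Lemma ler_sum_sub {R : realType} {T : choiceType} (f : T -> R) (s s' : seq T) :
  (forall t, 0 <= f t) -> uniq s -> uniq s' -> {subset s <= s'} ->
  \sum_(t <- s) f t <= \sum_(t <- s') f t.
Proof.
move=> f0 us us' ss'.
rewrite [leRHS](bigID (mem s)) /= -[leLHS]addr0 lerD //; last exact: sumr_ge0.
rewrite -[leRHS]big_filter le_eqVlt; apply/orP; left; apply/eqP.
apply: perm_big; apply: uniq_perm; rewrite ?filter_uniq // => t.
by rewrite mem_filter; case: (boolP (t \in s)) => // /ss'.
Qed.

Section UnorderedSums.
Context {R : realType} {T : choiceType}.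
Implicit Types f g h : T -> R.

(** Extended real values allow nonnegative families to be rearranged before they are known to be
    summable. *)
Definition nsum f : \bar R := \esum_(t in [set: T]) (f t)%:E.

Definition abs_summable f : Prop := (nsum (fun t => `|f t|%R) < +oo)%E.

(** As [fine] sends infinity to 0, the value is meaningful under [abs_summable]. *)
Definition tsum f : R :=
  fine (nsum (fun t => Num.max (f t) 0%R)) -
  fine (nsum (fun t => Num.max (- f t)%R 0%R)).

Lemma sum_le_nsum f (s : seq T) : (forall t, 0 <= f t) -> uniq s ->
  ((\sum_(t <- s) f t)%:E <= nsum f)%E.
Proof.
move=> f0 us; rewrite /nsum /esum; apply: ereal_sup_ubound => /=.
exists [set` s]; first by split.
rewrite fsbig_finite //= -sumEFin; apply: perm_big.
apply: uniq_perm => // t; rewrite in_fset_set //.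
by apply/idP/idP; rewrite inE.
Qed.

Lemma nsum_le f (M : \bar R) :
  (forall s : seq T, uniq s -> ((\sum_(t <- s) f t)%:E <= M)%E) ->
  (nsum f <= M)%E.
Proof.
move=> fM; apply: ge_ereal_sup => _ [A [finA _] <-].
by rewrite fsbig_finite //= sumEFin fM.
Qed.

Lemma nsum_ge0 f : (forall t, 0 <= f t) -> (0 <= nsum f)%E.
Proof. by move=> f0; apply: esum_ge0 => t _; rewrite lee_fin. Qed.

Lemma le_nsum f g : (forall t, f t <= g t) -> (nsum f <= nsum g)%E.
Proof. by move=> fg; apply: le_esum => t _; rewrite lee_fin. Qed.

Lemma nsumD f g : (forall t, 0 <= f t) -> (forall t, 0 <= g t) ->
  nsum (fun t => f t + g t) = (nsum f + nsum g)%E.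
Proof. by move=> f0 g0; rewrite -esumD // => t _; rewrite lee_fin. Qed.

Lemma nsum_fin_num f : (forall t, 0 <= f t) -> (nsum f < +oo)%E ->
  nsum f \is a fin_num.
Proof. by move=> f0 foo; rewrite ge0_fin_numE // nsum_ge0. Qed.

Lemma eq_nsum f g : f =1 g -> nsum f = nsum g.
Proof. by move=> /funext ->. Qed.

Lemma eq_tsum f g : f =1 g -> tsum f = tsum g.
Proof. by move=> /funext ->. Qed.

Lemma abs_summable_le f g : (forall t, `|f t| <= `|g t|) ->
  abs_summable g -> abs_summable f.
Proof. by move=> fg; apply: le_lt_trans; apply: le_nsum. Qed.

(** The positive and negative parts [f+], [f-] satisfy [g + f- = h + f+] pointwise, and additivity
    on nonnegative families concludes. Additivity and Fubini can then use whichever decomposition is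
    at hand. *)
Lemma tsumE f g h : (forall t, 0 <= g t) -> (forall t, 0 <= h t) ->
  (nsum g < +oo)%E -> (nsum h < +oo)%E -> (forall t, f t = g t - h t) ->
  tsum f = fine (nsum g) - fine (nsum h).
Proof.
move=> g0 h0 goo hoo fgh.
have p0 t : 0 <= Num.max (f t) 0 by rewrite le_max lexx orbT.
have n0 t : 0 <= Num.max (- f t) 0 by rewrite le_max lexx orbT.
have poo : (nsum (fun t => Num.max (f t) 0%R) < +oo)%E.
  apply: le_lt_trans goo; apply: le_nsum => t; rewrite ge_max g0 andbT fgh.
  by rewrite lerBlDr lerDl.
have noo : (nsum (fun t => Num.max (- f t)%R 0%R) < +oo)%E.
  apply: le_lt_trans hoo; apply: le_nsum => t; rewrite ge_max h0 andbT fgh.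
  by rewrite opprB lerBlDr lerDl.
apply/eqP; rewrite /tsum subr_eq addrAC eq_sym subr_eq -!fineD ?nsum_fin_num //.
rewrite -!nsumD //; apply/eqP; congr fine; apply: eq_nsum => t.
have := fgh t; case: (leP 0 (f t)) => f0.
  by rewrite max_r ?oppr_le0 // => ->; lra.
by rewrite max_l ?oppr_ge0 ?ltW // => ->; lra.
Qed.

Lemma tsum_ge0E f : (forall t, 0 <= f t) -> (nsum f < +oo)%E ->
  tsum f = fine (nsum f).
Proof.
move=> f0 foo; have z : nsum (fun=> 0%R : R) = 0%E by apply: esum1.
by rewrite (@tsumE _ f (fun=> 0)) ?z ?subr0 // => t; rewrite subr0.
Qed.

Lemma pos_part_lty f : abs_summable f ->
  (nsum (fun t => Num.max (f t) 0%R) < +oo)%E.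
Proof.
by apply: le_lt_trans; apply: le_nsum => t; rewrite ge_max ler_norm normr_ge0.
Qed.

Lemma abs_summableN f : abs_summable f -> abs_summable (fun t => - f t).
Proof. by apply: abs_summable_le => t; rewrite normrN. Qed.

Lemma pos_partB f t : f t = Num.max (f t) 0 - Num.max (- f t) 0.
Proof.
case: (leP 0 (f t)) => f0; first by rewrite max_r ?oppr_le0 // subr0.
by rewrite max_l ?oppr_ge0 ?ltW // sub0r opprK.
Qed.

Lemma pos_part_ge0 f t : 0 <= Num.max (f t) 0.
Proof. by rewrite le_max lexx orbT. Qed.

Lemma abs_summableD f g : abs_summable f -> abs_summable g ->
  abs_summable (fun t => f t + g t).
Proof.
move=> sf sg; apply: le_lt_trans (lte_add_pinfty sf sg).
by rewrite -nsumD //; apply: le_nsum => t; exact: ler_normD.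
Qed.

Lemma tsumD f g : abs_summable f -> abs_summable g ->
  tsum (fun t => f t + g t) = tsum f + tsum g.
Proof.
move=> sf sg; have sfN := abs_summableN sf; have sgN := abs_summableN sg.
pose p t := Num.max (f t) 0 + Num.max (g t) 0.
pose n t := Num.max (- f t) 0 + Num.max (- g t) 0.
have [pf pg nf ng] := And4 (pos_part_lty sf) (pos_part_lty sg)
  (pos_part_lty sfN) (pos_part_lty sgN).
rewrite (@tsumE _ p n).
- rewrite /p /n !nsumD; try exact: pos_part_ge0.
  rewrite !fineD ?nsum_fin_num //; try exact: pos_part_ge0.
  by rewrite /tsum; lra.
- by move=> t; rewrite addr_ge0 ?pos_part_ge0.
- move=> t; rewrite /n.
  by rewrite addr_ge0 // ?(pos_part_ge0 (fun t => - f t)) // ?(pos_part_ge0 (fun t => - g t)).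
- by rewrite nsumD ?lte_add_pinfty //; exact: pos_part_ge0.
- rewrite nsumD ?lte_add_pinfty //; exact: pos_part_ge0.
by move=> t; rewrite /p /n {1}(pos_partB f t) {1}(pos_partB g t); lra.
Qed.

Lemma tsumN f : tsum (fun t => - f t) = - tsum f.
Proof.
rewrite /tsum opprB; congr (_ - _); congr fine; apply: eq_nsum => t.
by rewrite opprK.
Qed.

Lemma le_tsum f g : abs_summable f -> abs_summable g ->
  (forall t, f t <= g t) -> tsum f <= tsum g.
Proof.
move=> sf sg fg; have sfN := abs_summableN sf; have sgN := abs_summableN sg.
rewrite /tsum lerB //; apply: fine_le.
- by apply: nsum_fin_num; [exact: pos_part_ge0|exact: pos_part_lty].
- by apply: nsum_fin_num; [exact: pos_part_ge0|exact: pos_part_lty].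
- by apply: le_nsum => t; rewrite ge_max !le_max fg lexx orbT.
- by apply: nsum_fin_num; [exact: pos_part_ge0|exact: pos_part_lty].
- by apply: nsum_fin_num; [exact: pos_part_ge0|exact: pos_part_lty].
- by apply: le_nsum => t; rewrite ge_max !le_max lerN2 fg lexx orbT.
Qed.

Lemma abs_summable_norm f : abs_summable f -> abs_summable (fun t => `|f t|).
Proof. by apply: abs_summable_le => t; rewrite normr_id. Qed.

Lemma ler_norm_tsum f : abs_summable f -> `|tsum f| <= tsum (fun t => `|f t|).
Proof.
move=> sf; have sa := abs_summable_norm sf; rewrite ler_norml; apply/andP; split.
  rewrite -tsumN; apply: le_tsum => //; first exact: abs_summableN.
  by move=> t; rewrite lerNl -normrN ler_norm.
by apply: le_tsum => // t; exact: ler_norm.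
Qed.

Lemma tsum_seq f (s : seq T) : uniq s -> (forall t, t \notin s -> f t = 0) ->
  abs_summable f /\ tsum f = \sum_(t <- s) f t.
Proof.
move=> us f0.
have sumE g : (forall t, 0 <= g t) -> (forall t, t \notin s -> g t = 0) ->
    nsum g = (\sum_(t <- s) g t)%:E.
  move=> g0 gs; apply/eqP; rewrite eq_le sum_le_nsum // andbT.
  apply: nsum_le => s' us'; rewrite lee_fin (bigID (mem s)) /=.
  rewrite [X in _ + X]big1 ?addr0; last by move=> t /gs.
  rewrite -big_filter; apply: ler_sum_sub; rewrite ?filter_uniq // => t.
  by rewrite mem_filter => /andP[].
have p0 t := pos_part_ge0 f t; have n0 t := pos_part_ge0 (fun t => - f t) t.
split; first by rewrite /abs_summable sumE ?ltry // => t /f0 ->; rewrite normr0.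
rewrite /tsum !sumE //.
- by rewrite -sumrB; apply: eq_bigr => t _; rewrite -pos_partB.
- by move=> t /f0 ->; rewrite oppr0 maxxx.
- by move=> t /f0 ->; rewrite maxxx.
Qed.

Lemma abs_summableZ a f : abs_summable f -> abs_summable (fun t => a * f t).
Proof.
move=> sf; apply: (@le_lt_trans _ _ (`|a| * fine (nsum (fun t => `|f t|%R)))%:E); last exact: ltry.
apply: nsum_le => s us; under eq_bigr do rewrite normrM.
rewrite -mulr_sumr lee_fin ler_wpM2l // -lee_fin fineK ?sum_le_nsum //.
by rewrite nsum_fin_num.
Qed.

Lemma tsum0 : tsum (fun=> 0) = 0.
Proof. by have [_ ->] := @tsum_seq (fun=> 0) [::] isT (fun _ _ => erefl); rewrite big_nil. Qed.

Lemma tsumZ a f : abs_summable f -> tsum (fun t => a * f t) = a * tsum f.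
Proof.
have pos b g : 0 <= b -> (forall t, 0 <= g t) -> abs_summable g ->
    nsum (fun t => b * g t) = (b * fine (nsum g))%:E.
  move=> b0 g0 sg.
  have sg' : (nsum g < +oo)%E.
    by apply: le_lt_trans sg; apply: le_nsum => t; exact: ler_norm.
  have gfin := nsum_fin_num g0 sg'.
  apply/eqP; rewrite eq_le; apply/andP; split.
    apply: nsum_le => s us.
    by rewrite -mulr_sumr lee_fin ler_wpM2l // -lee_fin fineK ?sum_le_nsum.
  have [->|b1] := eqVneq b 0.
    by rewrite mul0r; apply: nsum_ge0 => t; rewrite mul0r.
  have {}b0 : 0 < b by rewrite lt_neqAle eq_sym b1.
  rewrite EFinM muleC -lee_pdivlMr // fineK //.
  apply: nsum_le => s us; rewrite lee_pdivlMr // -EFinM mulrC mulr_sumr.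
  by apply: sum_le_nsum => // t; rewrite mulr_ge0 // ltW.
move=> sf; wlog a0 : a / 0 <= a => [H|].
  case: (leP 0 a) => [/H //|a0].
  have := H (- a); rewrite oppr_ge0 => /(_ (ltW a0)).
  rewrite mulNr (_ : (fun t => - a * f t) = (fun t => - (a * f t))) ?tsumN.
    by move/oppr_inj.
  by apply/funext => t; rewrite mulNr.
rewrite {1}/tsum.
have mE b x : 0 <= b :> R -> Num.max (b * x) 0 = b * Num.max x 0.
  by move=> b0; rewrite maxr_pMr // mulr0.
rewrite (_ : (fun t => Num.max (a * f t) 0) = (fun t => a * Num.max (f t) 0)); last first.
  by apply/funext => t; rewrite mE.
rewrite (_ : (fun t => Num.max (- (a * f t)) 0) = (fun t => a * Num.max (- f t) 0)); last first.
  by apply/funext => t; rewrite -mulrN mE.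
rewrite !pos //=; [by rewrite -mulrBr|..].
- exact: (pos_part_ge0 (fun t => - f t)).
- apply: abs_summable_le sf => t; rewrite ger0_norm ?ge_max; last exact: (pos_part_ge0 (fun t => - f t)).
  by rewrite normr_ge0 -normrN ler_norm.
- exact: pos_part_ge0.
- apply: abs_summable_le sf => t; rewrite ger0_norm ?ge_max; last exact: pos_part_ge0.
  by rewrite normr_ge0 ler_norm.
Qed.

End UnorderedSums.

Section Fubini.
Context {R : realType} {T U : choiceType}.
Implicit Type f : T * U -> R.

Lemma nsum_pair f : (forall p, 0 <= f p) ->
  nsum f = \esum_(t in [set: T]) nsum (fun u => f (t, u)).
Proof.
move=> f0; rewrite /nsum (@esum_esum _ _ _ setT (fun=> setT) (fun t u => (f (t, u))%:E)).
  rewrite (_ : [set: T] `*`` (fun=> [set: U]) = setT).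
    by apply: eq_esum => -[t u].
  by apply/seteqP; split.
by move=> t u _ _; rewrite lee_fin.
Qed.

Lemma nsum_swap f : (forall p, 0 <= f p) ->
  nsum f = nsum (fun p : U * T => f (p.2, p.1)).
Proof.
move=> f0; rewrite /nsum.
rewrite (@reindex_esum R _ _ setT setT (fun p : U * T => (p.2, p.1))) //.
split=> //; first by move=> [a b] [a' b'] _ _ [-> ->].
by move=> [t u] _; exists (u, t).
Qed.

Lemma abs_summable_swap f : abs_summable f ->
  abs_summable (fun p : U * T => f (p.2, p.1)).
Proof. by rewrite /abs_summable nsum_swap. Qed.

Lemma tsum_swap f : tsum f = tsum (fun p : U * T => f (p.2, p.1)).
Proof.
rewrite /tsum !(@nsum_swap (fun p => Num.max _ _)) // => p; first exact: (pos_part_ge0 (fun t => - f t)).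
exact: pos_part_ge0.
Qed.

Lemma abs_summable_slice f t : abs_summable f -> abs_summable (fun u => f (t, u)).
Proof.
apply: le_lt_trans; apply: nsum_le => s us.
rewrite (_ : \sum_(u <- s) _ = \sum_(p <- [seq (t, u) | u <- s]) `|f p|).
  by apply: sum_le_nsum => //; rewrite map_inj_uniq // => u v [].
by rewrite big_map.
Qed.

Let nsum_fine f : (forall p, 0 <= f p) -> (nsum f < +oo)%E ->
  nsum f = nsum (fun t => fine (nsum (fun u => f (t, u)))).
Proof.
move=> f0 foo; rewrite nsum_pair //; apply: eq_esum => t _; rewrite fineK //.
apply: nsum_fin_num => //.
have : abs_summable (fun u => f (t, u)).
  apply: abs_summable_slice; apply: le_lt_trans foo.
  by apply: le_nsum => p; rewrite ger0_norm.
by apply: le_lt_trans; apply: le_nsum => u; exact: ler_norm.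
Qed.

Lemma abs_summable_fubini f : abs_summable f ->
  abs_summable (fun t => tsum (fun u => f (t, u))).
Proof.
move=> sf; rewrite /abs_summable in sf *.
apply: (@le_lt_trans _ _ (nsum (fun t => fine (nsum (fun u => `|f (t, u)|))))); last first.
  by rewrite -(@nsum_fine (fun p => `|f p|)).
apply: le_nsum => t; have st := abs_summable_slice t sf.
by rewrite (le_trans (ler_norm_tsum st)) // tsum_ge0E.
Qed.

Lemma fubini_tsum f : abs_summable f ->
  tsum f = tsum (fun t => tsum (fun u => f (t, u))).
Proof.
move=> sf; have sfN := abs_summableN sf.
have n0 := pos_part_ge0 (fun t => - f t); have p0 := pos_part_ge0 f.
have pl := pos_part_lty sf; have nl := pos_part_lty sfN.
have fin0 g : (forall p, 0 <= g p) -> forall t : T, 0 <= fine (nsum (fun u : U => g (t, u) : R)).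
  by move=> g0 t; rewrite fine_ge0 // nsum_ge0.
rewrite [in RHS](@tsumE _ _ _ (fun t => fine (nsum (fun u => Num.max (f (t, u)) 0)))
  (fun t => fine (nsum (fun u => Num.max (- f (t, u)) 0)))).
- by rewrite -(@nsum_fine (fun p => Num.max (f p) 0)) // -(@nsum_fine (fun p => Num.max (- f p) 0)).
- exact: (fin0 (fun p => Num.max (f p) 0)).
- exact: (fin0 (fun p => Num.max (- f p) 0)).
- by rewrite -(@nsum_fine (fun p => Num.max (f p) 0)).
- by rewrite -(@nsum_fine (fun p => Num.max (- f p) 0)).
- by [].
Qed.

End Fubini.

Lemma exchange_tsum {R : realType} {T U : choiceType} (f : T -> U -> R) :
  abs_summable (fun p : T * U => f p.1 p.2) ->
  tsum (fun t => tsum (f t)) = tsum (fun u => tsum (f^~ u)).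
Proof.
move=> sf; rewrite -(@fubini_tsum _ _ _ (fun p => f p.1 p.2)) // [LHS]tsum_swap.
exact: fubini_tsum (abs_summable_swap sf).
Qed.


(** * Square partial sums and unordered sums *)

Section SquareSums.
Context {R : realType}.
Implicit Type u : nat -> nat -> R.

Let square N := [seq (i, j) | i <- index_iota 0 N, j <- index_iota 0 N].

Let uniq_square N : uniq (square N).
Proof. by apply: allpairs_uniq; rewrite ?iota_uniq // => -[i j] [k l]. Qed.

Let mem_square N p : (p \in square N) = (p.1 < N)%N && (p.2 < N)%N.
Proof.
case: p => i j; apply/allpairsP/andP => /=.
  by move=> [[k l]] /=; rewrite !mem_index_iota => -[kN lN [-> ->]]; lia.
by move=> [iN jN]; exists (i, j); rewrite /= !mem_index_iota; split => //; lia.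
Qed.

Let square_sumE u N : square_sum u N = \sum_(p <- square N) u p.1 p.2.
Proof.
rewrite /square_sum big_allpairs /= big_mkord.
by apply: eq_bigr => i _; rewrite big_mkord.
Qed.

(** Any finite set of indices lies in a square. *)
Lemma square_sum_abs_summable u (M : R) :
  (forall N, square_sum (fun i j => `|u i j|) N <= M) ->
  abs_summable (fun p => u p.1 p.2).
Proof.
move=> uM; apply: (@le_lt_trans _ _ M%:E); last exact: ltry.
apply: nsum_le => s us; pose N := (\max_(p <- s) maxn p.1 p.2).+1.
rewrite lee_fin (le_trans _ (uM N)) // square_sumE.
have sN p : p \in s -> p \in square N.
  move=> ps; rewrite mem_square /N !ltnS -geq_max.
  by rewrite (big_rem p) //= leq_max leqnn.
by apply: ler_sum_sub.
Qed.

Lemma square_sum_cvg u : abs_summable (fun p => u p.1 p.2) ->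
  square_sum u @ \oo --> tsum (fun p => u p.1 p.2).
Proof.
have pos (v : nat -> nat -> R) : (forall i j, 0 <= v i j) -> (nsum (fun p => v p.1 p.2) < +oo)%E ->
    square_sum v @ \oo --> fine (nsum (fun p => v p.1 p.2)).
  move=> v0 vs; have vfin := nsum_fin_num (fun p => v0 p.1 p.2) vs.
  have hub N : square_sum v N <= fine (nsum (fun p => v p.1 p.2)).
    by rewrite square_sumE -lee_fin fineK //; apply: sum_le_nsum.
  have hlb e : 0 < e -> exists N0, forall N, (N0 <= N)%N ->
      fine (nsum (fun p => v p.1 p.2)) - e <= square_sum v N.
    move=> e0; have [s us hs] : exists2 s, uniq s &
        fine (nsum (fun p => v p.1 p.2)) - e <= \sum_(p <- s) v p.1 p.2.
      apply: contrapT => H.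
      have : (nsum (fun p => v p.1 p.2) <= (fine (nsum (fun p => v p.1 p.2)) - e)%:E)%E.
        apply: nsum_le => s us; rewrite lee_fin leNgt; apply/negP => hs.
        by apply: H; exists s => //; exact: ltW.
      by rewrite -[X in (X <= _)%E -> _]fineK // lee_fin; lra.
    exists (\max_(p <- s) maxn p.1 p.2).+1 => N hN.
    apply: (le_trans hs); rewrite square_sumE; apply: ler_sum_sub => // p ps.
    rewrite mem_square -gtn_max; apply: leq_trans hN.
    by rewrite ltnS (big_rem p) //= leq_max leqnn.
  apply/cvgrPdist_le => e /hlb[N0 hN0]; exists N0 => // N /= /hN0 h.
  by rewrite ger0_norm ?subr_ge0 //; move: h; rewrite lerBlDl -lerBlDr.
move=> su; have suN := abs_summableN su.
rewrite (_ : square_sum u = (fun N => square_sum (fun i j => Num.max (u i j) 0) N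
   - square_sum (fun i j => Num.max (- u i j) 0) N)).
  apply: cvgB; apply: pos.
  - by move=> i j; rewrite le_max lexx orbT.
  - exact: pos_part_lty su.
  - by move=> i j; rewrite le_max lexx orbT.
  - exact: pos_part_lty suN.
apply/funext => N; rewrite /square_sum -sumrB; apply: eq_bigr => i _.
rewrite -sumrB; apply: eq_bigr => j _.
exact: (pos_partB (fun p : nat * nat => u p.1 p.2) (val i, val j)).
Qed.

(** Bridge from the definition of analyticity to unordered sums, for which reindexing and Fubini are
    available. *)
Lemma abs_sums_toP u l :
  abs_sums_to u l <-> abs_summable (fun p => u p.1 p.2) /\ tsum (fun p => u p.1 p.2) = l.
Proof.
split=> [[cu ul]|[su <-]]; last first.
  split; last exact: square_sum_cvg.
  apply/cvg_ex; eexists.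
  apply: (@square_sum_cvg (fun i j => `|u i j|)).
  exact: abs_summable_norm su.
have su : abs_summable (fun p => u p.1 p.2).
  apply: (@square_sum_abs_summable _ (limn (square_sum (fun i j => `|u i j|)))).
  move=> N; apply: nondecreasing_cvgn_le => //.
  apply/nondecreasing_seqP => n; rewrite !square_sumE.
  by apply: ler_sum_sub => // p; rewrite !mem_square; lia.
split=> //; have := square_sum_cvg su => h.
exact: (cvg_unique _ h ul).
Qed.

End SquareSums.

(** * Double power series *)

Section NearPair.
Context {R : realType}.

Lemma near_boxP (p : R * R) (P : R * R -> Prop) :
  (\forall q \near p, P q) <-> exists2 r : R, 0 < r &
    forall h k, `|h| < r -> `|k| < r -> P (p.1 + h, p.2 + k).
Proof.
split=> [/nbhs_ballP[r /= r0 rP]|[r r0 rP]].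
  exists r => // h k hr kr; apply: rP; split; rewrite /ball /= opprD addrA subrr sub0r normrN //.
apply/nbhs_ballP; exists r => //= -[x y] [/= px py].
have := rP (x - p.1) (y - p.2); rewrite ![_ + (_ - _)]addrC !subrK; apply.
  by move: px; rewrite /ball /= distrC.
by move: py; rewrite /ball /= distrC.
Qed.

Lemma near0_boxP (P : R * R -> Prop) :
  (\forall q \near ((0, 0) : R * R), P q) <-> exists2 r : R, 0 < r &
    forall x y, `|x| < r -> `|y| < r -> P (x, y).
Proof.
rewrite near_boxP /=; split=> -[r r0 rP]; exists r => // x y.
  by rewrite -[x in (x, _)]add0r -[y in (_, y)]add0r; exact: rP.
by rewrite !add0r; exact: rP.
Qed.

End NearPair.

Section Reindexing.
Context {R : realType} {T T' : choiceType}.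
Variables (e : T -> T') (f : T' -> R).
Hypothesis e_inj : injective e.
Hypothesis f0 : forall t, ~ (exists s, e s = t) -> f t = 0.

Let nsum_comp g : (forall t, ~ (exists s, e s = t) -> g t = 0) ->
  nsum g = nsum (fun s => g (e s)) :> \bar R.
Proof.
move=> g0; rewrite /nsum -(@esum_image _ _ _ setT e (fun t => (g t)%:E)); last first.
  by move=> x y _ _; exact: e_inj.
rewrite [RHS]esum_mkcond; apply: eq_esum => t _; case: ifPn => // /negP te.
by rewrite g0 // => -[s est]; apply: te; rewrite inE; exists s.
Qed.

Lemma abs_summable_inj : abs_summable f <-> abs_summable (fun s => f (e s)).
Proof.
by rewrite /abs_summable (nsum_comp (g := fun t => `|f t|)) // => t /f0 ->; rewrite normr0.
Qed.

Lemma tsum_inj : tsum f = tsum (fun s => f (e s)).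
Proof.
by rewrite /tsum !nsum_comp // => t /f0 ->; rewrite ?oppr0 maxxx.
Qed.

End Reindexing.

Section PowerSeries.
Context {R : realType}.
Implicit Types c d : nat -> nat -> R.

Definition monomials c (x y : R) : nat * nat -> R :=
  fun p => c p.1 p.2 * x ^+ p.1 * y ^+ p.2.

Definition pseries2 c (p : R * R) : R := tsum (monomials c p.1 p.2).

(** Cauchy's estimates: convergence near the origin expressed on coefficients alone, a form stable
    under shifts and formal differentiation. With [1 <= M] exponents may be enlarged. *)
Definition geo_bounded c : Prop := exists C M : R,
  [/\ 0 <= C, 1 <= M & forall i j, `|c i j| <= C * M ^+ (i + j)].

Lemma abs_summable_half : abs_summable (fun p : nat * nat => (2^-1 : R) ^+ (p.1 + p.2)).
Proof.
apply: (@square_sum_abs_summable _ (fun i j => 2^-1 ^+ (i + j)) 4) => N.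
have geo n : \sum_(i < n) (2^-1 : R) ^+ i <= 2.
  suff -> : \sum_(i < n) (2^-1 : R) ^+ i = 2 - 2 * 2^-1 ^+ n.
    by rewrite gerBl mulr_ge0 ?exprn_ge0 ?invr_ge0.
  elim: n => [|n IH]; first by rewrite big_ord0 expr0; lra.
  by rewrite big_ord_recr /= IH exprS; field.
rewrite /square_sum; under eq_bigr => i _.
  under eq_bigr => j _ do rewrite ger0_norm ?exprn_ge0 ?invr_ge0 // exprD.
  rewrite -mulr_sumr; over.
rewrite -mulr_suml (_ : 4 = 2 * 2 :> R); last by ring.
by apply: ler_pM => //; apply: sumr_ge0 => i _; rewrite exprn_ge0 ?invr_ge0.
Qed.

Lemma abs_summable_monomials c (C M x y : R) : 0 <= C -> 0 <= M ->
  (forall i j, `|c i j| <= C * M ^+ (i + j)) ->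
  M * `|x| <= 2^-1 -> M * `|y| <= 2^-1 -> abs_summable (monomials c x y).
Proof.
move=> C0 M0 cM xM yM.
apply: (@abs_summable_le _ _ _ (fun p => C * 2^-1 ^+ (p.1 + p.2))); last first.
  exact/abs_summableZ/abs_summable_half.
move=> [i j] /=; rewrite /monomials /= !normrM !normrX (ger0_norm C0).
rewrite (ger0_norm (_ : 0 <= 2^-1 :> R)) ?invr_ge0 //.
apply: (@le_trans _ _ (C * M ^+ (i + j) * `|x| ^+ i * `|y| ^+ j)).
  by rewrite -[leLHS]mulrA -[leRHS]mulrA ler_wpM2r // mulr_ge0 ?exprn_ge0.
rewrite !exprD -!mulrA ler_wpM2l //.
rewrite [M ^+ j * _]mulrCA !mulrA -exprMn -mulrA -exprMn.
by apply: ler_pM; rewrite ?exprn_ge0 ?mulr_ge0 // lerXn2r ?nnegrE ?mulr_ge0 ?invr_ge0.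
Qed.

Lemma near_abs_summable c : geo_bounded c ->
  \forall p \near ((0, 0) : R * R), abs_summable (monomials c p.1 p.2).
Proof.
move=> [C [M [C0 M1 cM]]]; have M0 : 0 < M by lra.
apply/near0_boxP; exists ((2 * M)^-1); first by rewrite invr_gt0 mulr_gt0.
have small z : `|z| < (2 * M)^-1 -> M * `|z| <= 2^-1.
  by move=> /ltW; rewrite -ler_pdivlMl // -invfM mulrC.
by move=> x y /small xM /small yM; apply: abs_summable_monomials cM _ _ => //; exact: ltW.
Qed.

Lemma geo_bounded_summable c (r : R) : 0 < r ->
  abs_summable (monomials c r r) -> geo_bounded c.
Proof.
move=> r0 sc; pose C := tsum (fun p => `|monomials c r r p|).
have C0 : 0 <= C by rewrite (le_trans _ (ler_norm_tsum sc)).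
have h i j : `|c i j| <= C * r^-1 ^+ (i + j).
  rewrite exprVn ler_pdivlMr ?exprn_gt0 //.
  have -> : `|c i j| * r ^+ (i + j) = `|monomials c r r (i, j)|.
    by rewrite /monomials /= !normrM !normrX (gtr0_norm r0) exprD mulrA.
  have sa := abs_summable_norm sc.
  rewrite /C tsum_ge0E // -lee_fin fineK ?nsum_fin_num //.
  by have := @sum_le_nsum _ _ (fun p => `|monomials c r r p|) [:: (i, j)] _ isT; rewrite big_seq1; apply.
exists C, (Num.max 1 r^-1); split; rewrite ?le_max ?lexx // => i j.
apply: (le_trans (h i j)); rewrite ler_wpM2l // lerXn2r ?nnegrE ?le_max ?lexx ?ler01 ?orbT //.
by rewrite invr_ge0 ltW.
Qed.

Lemma geo_boundedD c d : geo_bounded c -> geo_bounded d ->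
  geo_bounded (fun i j => c i j + d i j).
Proof.
move=> [C [M [C0 M1 cM]]] [C' [M' [C'0 M'1 dM]]].
exists (C + C'), (Num.max M M'); split; rewrite ?addr_ge0 ?le_max ?M1 // => i j.
rewrite (le_trans (ler_normD _ _)) // mulrDl lerD //.
  by apply: (le_trans (cM i j)); rewrite ler_wpM2l // lerXn2r ?nnegrE ?le_max ?lexx //; lra.
apply: (le_trans (dM i j)); rewrite ler_wpM2l // lerXn2r ?nnegrE ?le_max ?lexx ?orbT //; first lra.
by apply/orP; left; lra.
Qed.

Lemma geo_boundedZ (b : R) c : geo_bounded c -> geo_bounded (fun i j => b * c i j).
Proof.
move=> [C [M [C0 M1 cM]]]; exists (`|b| * C), M; split => //; first exact: mulr_ge0.
by move=> i j; rewrite normrM -mulrA ler_wpM2l.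
Qed.

Lemma geo_bounded_const (b : R) : geo_bounded (fun i j => if (i == 0)%N && (j == 0)%N then b else 0).
Proof.
exists `|b|, 1; split; rewrite ?lexx //; move=> i j; rewrite expr1n mulr1.
by case: ifP => //; rewrite normr0.
Qed.

Lemma geo_bounded_sum n (F : nat -> nat -> nat -> R) :
  (forall k, geo_bounded (F k)) -> geo_bounded (fun i j => \sum_(k < n) F k i j).
Proof.
move=> FM; elim: n => [|n IH].
  by exists 0, 1; split; rewrite ?lexx // => i j; rewrite big_ord0 normr0 mul0r.
have [C [M [C0 M1 cM]]] := geo_boundedD IH (FM n).
by exists C, M; split => // i j; rewrite big_ord_recr; exact: cM.
Qed.

Lemma geo_bounded_shift k l c : geo_bounded c -> geo_bounded (shift_coef k l c).
Proof.
move=> [C [M [C0 M1 cM]]]; exists C, M; split => // i j.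
rewrite /shift_coef; case: ifP => _; last by rewrite normr0 mulr_ge0 // exprn_ge0 //; lra.
by apply: (le_trans (cM _ _)); rewrite ler_wpM2l // ler_weXn2l //; lia.
Qed.

Let natr_le_expr n : n.+1%:R <= (2 : R) ^+ n.
Proof. by rewrite -natrX ler_nat ltn_expl. Qed.

(** Doubling [M] absorbs the factor [i.+1], which is at most [2 ^+ i]. *)
Lemma geo_bounded_dx c : geo_bounded c -> geo_bounded (dx c).
Proof.
move=> [C [M [C0 M1 cM]]]; exists (C * M), (2 * M); split => [||i j].
- by rewrite mulr_ge0 //; lra.
- by lra.
rewrite /dx normrM normr_nat exprMn.
have -> : C * M * (2 ^+ (i + j) * M ^+ (i + j)) = 2 ^+ (i + j) * (C * M ^+ (i.+1 + j)).
  by rewrite addSn exprS; ring.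
apply: ler_pM => //; apply: (le_trans (natr_le_expr _)).
by rewrite ler_weXn2l //; [lra|lia].
Qed.

Lemma geo_bounded_dy c : geo_bounded c -> geo_bounded (dy c).
Proof.
move=> [C [M [C0 M1 cM]]]; exists (C * M), (2 * M); split => [||i j].
- by rewrite mulr_ge0 //; lra.
- by lra.
rewrite /dy normrM normr_nat exprMn.
have -> : C * M * (2 ^+ (i + j) * M ^+ (i + j)) = 2 ^+ (i + j) * (C * M ^+ (i + j.+1)).
  by rewrite addnS exprS; ring.
apply: ler_pM => //; apply: (le_trans (natr_le_expr _)).
by rewrite ler_weXn2l //; [lra|lia].
Qed.

Lemma pseries2D c d (p : R * R) :
  abs_summable (monomials c p.1 p.2) -> abs_summable (monomials d p.1 p.2) ->
  pseries2 (fun i j => c i j + d i j) p = pseries2 c p + pseries2 d p.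
Proof.
move=> sc sd; rewrite /pseries2 -tsumD //; apply: eq_tsum => -[i j].
by rewrite /monomials !mulrDl.
Qed.

Lemma pseries2Z (b : R) c (p : R * R) : abs_summable (monomials c p.1 p.2) ->
  pseries2 (fun i j => b * c i j) p = b * pseries2 c p.
Proof.
by move=> sc; rewrite /pseries2 -tsumZ //; apply: eq_tsum => -[i j]; rewrite /monomials !mulrA.
Qed.

Lemma pseries2_0 (p : R * R) : pseries2 (fun _ _ => 0) p = 0.
Proof.
apply: etrans (@tsum0 R (nat * nat)%type); apply: eq_tsum => q.
by rewrite /monomials !mul0r.
Qed.

Lemma pseries2_const (b : R) (p : R * R) :
  pseries2 (fun i j => if (i == 0)%N && (j == 0)%N then b else 0) p = b.
Proof.
pose u : nat -> nat -> R := fun i j => if (i == 0)%N && (j == 0)%N then b else 0.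
have [|_ uE] := @tsum_seq _ _ (monomials u p.1 p.2) [:: (0, 0)%N] isT.
  move=> [i j]; rewrite inE xpair_eqE /monomials /u /= => /negPf ->.
  by rewrite !mul0r.
by rewrite [LHS]uE big_seq1 /monomials /= !mulr1.
Qed.

Let shift_off k l c (x y : R) (q : nat * nat) :
  ~ (exists p : nat * nat, (p.1 + k, p.2 + l)%N = q) ->
  monomials (shift_coef k l c) x y q = 0.
Proof.
case: q => i j H; rewrite /monomials /shift_coef /=; case: ifP; rewrite ?mul0r //.
by move=> /andP[ki lj]; case: H; exists (i - k, j - l)%N; rewrite /= !subnK.
Qed.

Let shift_on k l c (x y : R) (q : nat * nat) :
  monomials (shift_coef k l c) x y (q.1 + k, q.2 + l)%N =
  x ^+ k * y ^+ l * monomials c x y q.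
Proof.
rewrite /monomials /shift_coef /= !leq_addl !addnK /= !exprD; ring.
Qed.

Let shift_inj k l : injective (fun q : nat * nat => (q.1 + k, q.2 + l)%N).
Proof. by move=> [i j] [i' j'] [/addIn -> /addIn ->]. Qed.

Lemma abs_summable_shift k l c (x y : R) :
  abs_summable (monomials c x y) -> abs_summable (monomials (shift_coef k l c) x y).
Proof.
move=> sc; apply/(abs_summable_inj (@shift_inj k l) (@shift_off k l c x y)).
rewrite (_ : (fun q => _) = fun q => x ^+ k * y ^+ l * monomials c x y q).
  exact: abs_summableZ.
by apply/funext => q; exact: shift_on.
Qed.

Lemma pseries2_shift k l c (p : R * R) : abs_summable (monomials c p.1 p.2) ->
  pseries2 (shift_coef k l c) p = p.1 ^+ k * p.2 ^+ l * pseries2 c p.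
Proof.
move=> sc; rewrite /pseries2 -tsumZ //.
rewrite (tsum_inj (@shift_inj k l) (@shift_off k l c p.1 p.2)).
by apply: eq_tsum => q; exact: shift_on.
Qed.

(* Taylor coefficients at [p] of the sum of the power series [c]. *)
Definition taylor2 c (p : R * R) (a b : nat) : R :=
  tsum (fun q : nat * nat =>
    c q.1 q.2 * ('C(q.1, a)%:R * p.1 ^+ (q.1 - a)) * ('C(q.2, b)%:R * p.2 ^+ (q.2 - b))).

Lemma binomial2_tsum (x y h k : R) m n :
  let F (q : nat * nat) := 'C(m, q.1)%:R * x ^+ (m - q.1) * h ^+ q.1
    * ('C(n, q.2)%:R * y ^+ (n - q.2) * k ^+ q.2) in
  abs_summable F /\ tsum F = (x + h) ^+ m * (y + k) ^+ n.
Proof.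
move=> F.
pose s := [seq (a, b) | a <- index_iota 0 m.+1, b <- index_iota 0 n.+1].
have us : uniq s by apply: allpairs_uniq; rewrite ?iota_uniq // => -[i j] [i' j'].
have [|sF ->] := @tsum_seq _ _ F s us.
  move=> [a b] /allpairsPdep H; rewrite /F /=.
  have [ma|am] := ltnP m a; first by rewrite bin_small ?mul0r.
  have [nb|bn] := ltnP n b; first by rewrite ['C(n, b)]bin_small // !mul0r mulr0.
  by case: H; exists a, b; rewrite !mem_index_iota.
split=> //; rewrite /s big_allpairs /= !big_mkord !exprDn mulr_suml.
apply: eq_bigr => a _; rewrite big_mkord mulr_sumr; apply: eq_bigr => b _.
by rewrite /F /= -[_ *+ 'C(m, a)]mulr_natl -[_ *+ 'C(n, b)]mulr_natl; ring.
Qed.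

(** * Re-expansion of a double series at a nearby point *)

Section TaylorExpansion.
Variables (c : nat -> nat -> R) (C M : R).
Hypotheses (C0 : 0 <= C) (M1 : 1 <= M).
Hypothesis cM : forall i j, `|c i j| <= C * M ^+ (i + j).

Let M0 : 0 < M. Proof. by move: M1; lra. Qed.

(** When centre and increment are both below [r], the sum of their absolute values times [M] is at
    most 1/2, the ratio of the geometric majorant. *)
Let r := (4 * M)^-1.
Let r0 : 0 < r. Proof. by rewrite invr_gt0 mulr_gt0. Qed.

Let small (x h : R) : `|x| < r -> `|h| < r -> M * (`|x| + `|h|) <= 2^-1.
Proof.
move=> xr hr; have Mr : M * r = 4^-1.
  by rewrite /r invfM mulrCA divff ?mulr1 // gt_eqF.
have : M * (`|x| + `|h|) <= M * (r + r) by rewrite ler_wpM2l ?lerD // ltW.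
by rewrite [M * (r + r)]mulrDr Mr; lra.
Qed.

(** All monomials at [p + (h, k)], expanded binomially. Summation over [z.2] restores the monomials
    at the new point, summation over [z.1] yields the Taylor monomials at [p]. *)
Let G (p : R * R) (h k : R) (z : (nat * nat) * (nat * nat)) :=
  c z.1.1 z.1.2 *
   ('C(z.1.1, z.2.1)%:R * p.1 ^+ (z.1.1 - z.2.1) * h ^+ z.2.1
    * ('C(z.1.2, z.2.2)%:R * p.2 ^+ (z.1.2 - z.2.2) * k ^+ z.2.2)).

Let abs_summable_G (p : R * R) h k :
  `|p.1| < r -> `|p.2| < r -> `|h| < r -> `|k| < r -> abs_summable (G p h k).
Proof.
move=> p1r p2r hr kr; rewrite /abs_summable nsum_pair //.
have sabs : abs_summable (monomials (fun i j => `|c i j|) (`|p.1| + `|h|) (`|p.2| + `|k|)).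
  apply: (@abs_summable_monomials _ C M) => //; first exact: ltW.
  - by move=> i j; rewrite normr_id.
  - by rewrite (ger0_norm (_ : 0 <= `|p.1| + `|h|)) ?addr_ge0 // small.
  - by rewrite (ger0_norm (_ : 0 <= `|p.2| + `|k|)) ?addr_ge0 // small.
apply: le_lt_trans sabs; rewrite /nsum; apply: le_esum => -[m n] _ /=.
have [sF eF] := binomial2_tsum `|p.1| `|p.2| `|h| `|k| m n.
have sF' := abs_summableZ `|c m n| sF.
rewrite (_ : \esum_(_ in _) _ = nsum (fun q : nat * nat => `|c m n| *
   ('C(m, q.1)%:R * `|p.1| ^+ (m - q.1) * `|h| ^+ q.1
    * ('C(n, q.2)%:R * `|p.2| ^+ (n - q.2) * `|k| ^+ q.2)))); last first.
  by apply: eq_esum => -[a b] _; rewrite /G /= !normrM !normrX !normr_nat.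
rewrite -[X in (X <= _)%E]fineK; last first.
  apply: nsum_fin_num; first by move=> q; rewrite !mulr_ge0 ?exprn_ge0.
  by apply: le_lt_trans sF'; apply: le_nsum => q; exact: ler_norm.
rewrite -tsum_ge0E; last first.
- by apply: le_lt_trans sF'; apply: le_nsum => q; exact: ler_norm.
- by move=> q; rewrite !mulr_ge0 ?exprn_ge0.
rewrite tsumZ // eF lee_fin /monomials /= !normrM normr_id !normrX.
by rewrite !(ger0_norm (addr_ge0 _ _)) // mulrA.
Qed.

Let abs_summable_taylor (p : R * R) a b : `|p.1| < r -> `|p.2| < r ->
  abs_summable (fun q : nat * nat =>
    c q.1 q.2 * ('C(q.1, a)%:R * p.1 ^+ (q.1 - a)) * ('C(q.2, b)%:R * p.2 ^+ (q.2 - b))).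
Proof.
(* The Taylor family is a slice of [G] at a nonzero increment [s], divided by [s ^+ a * s ^+ b]. *)
move=> p1r p2r; pose s := r / 2.
have s0 : 0 < s by rewrite divr_gt0.
have sr : `|s| < r by rewrite gtr0_norm // /s; have := r0; lra.
have /abs_summable_swap /abs_summable_slice : abs_summable (G p s s).
  exact: abs_summable_G.
move=> /(_ (a, b)) /(abs_summableZ ((s ^+ a * s ^+ b)^-1)).
apply: abs_summable_le => -[m n]; rewrite /G /= le_eqVlt; apply/orP; left; apply/eqP.
congr `|_|; field; apply/andP; split; exact: expf_neq0 (lt0r_neq0 s0).
Qed.

Lemma taylor2P (p : R * R) (h k : R) :
  `|p.1| < r -> `|p.2| < r -> `|h| < r -> `|k| < r ->
  abs_summable (monomials (taylor2 c p) h k) /\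
  pseries2 (taylor2 c p) (h, k) = pseries2 c (p.1 + h, p.2 + k).
Proof.
move=> p1r p2r hr kr; have sG := abs_summable_G p1r p2r hr kr.
have tE q : monomials (taylor2 c p) h k q = tsum (fun mn => G p h k (mn, q)).
  case: q => a b; rewrite /monomials /taylor2 /= -mulrA [_ * (_ * _)]mulrC -tsumZ.
    by apply: eq_tsum => -[m n]; rewrite /G /=; ring.
  exact: abs_summable_taylor.
split.
  rewrite (_ : monomials _ _ _ = fun q => tsum (fun mn => G p h k (mn, q))).
    exact: abs_summable_fubini (abs_summable_swap sG).
  by apply/funext.
rewrite /pseries2 /= (eq_tsum tE).
rewrite -(@exchange_tsum _ _ _ (fun mn q => G p h k (mn, q))); last first.
  by rewrite (_ : (fun p0 => _) = G p h k) //; apply/funext => -[].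
apply: eq_tsum => -[m n].
have [sF eF] := binomial2_tsum p.1 p.2 h k m n.
by rewrite [LHS](tsumZ (c m n) sF) eF /monomials /= mulrA.
Qed.

Lemma taylor2_10 (p : R * R) : taylor2 c p 1 0 = pseries2 (dx c) p.
Proof.
rewrite /taylor2 /pseries2 (@tsum_inj _ _ _ (fun q : nat * nat => (q.1.+1, q.2))).
- by apply: eq_tsum => -[i j]; rewrite /monomials /dx /= bin1 bin0 subn1 subn0 /=; ring.
- by move=> [i j] [i' j'] [-> ->].
move=> [[|i] j] H; first by rewrite /= !mul0r mulr0 mul0r.
by case: H; exists (i, j).
Qed.

Lemma taylor2_01 (p : R * R) : taylor2 c p 0 1 = pseries2 (dy c) p.
Proof.
rewrite /taylor2 /pseries2 (@tsum_inj _ _ _ (fun q : nat * nat => (q.1, q.2.+1))).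
- by apply: eq_tsum => -[i j]; rewrite /monomials /dy /= bin1 bin0 subn1 subn0 /=; ring.
- by move=> [i j] [i' j'] [-> ->].
move=> [i [|j]] H; first by rewrite /= !mul0r mulr0.
by case: H; exists (i, j).
Qed.

End TaylorExpansion.

End PowerSeries.

(** * Differentiation of double power series and the identity theorem *)

Section AnalyticDerivatives.
Context {R : realType}.
Implicit Types (c d : nat -> nat -> R) (H : R * R -> R).

Definition linear_form (A B : R) (v : R * R) : R := A * v.1 + B * v.2.

Lemma linear_form_is_linear A B : linear (linear_form A B).
Proof. by move=> a u v; rewrite /linear_form /= /GRing.scale /=; ring. Qed.

HB.instance Definition _ A B :=
  GRing.isLinear.Build R (R * R)%type R _ (linear_form A B) (linear_form_is_linear A B).

Lemma continuous_linear_form A B : continuous (linear_form A B).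
Proof.
move=> v; apply: cvgD; apply: cvgM; try exact: cvg_cst.
  exact: cvg_fst.
exact: cvg_snd.
Qed.

Lemma is_diff_quadratic H (p : R * R) (A B K r : R) : 0 < r ->
  (forall h k, `|h| < r -> `|k| < r ->
     `|H (p.1 + h, p.2 + k) - H p - (A * h + B * k)| <= K * Num.max `|h| `|k| ^+ 2) ->
  is_diff p H (linear_form A B).
Proof.
move=> r0 HK.
have lit : H \o shift p = cst (H p) + linear_form A B +o_ (0 : R * R) id.
  apply/eqaddoP => e e0.
  pose d := Num.min r (e / (`|K| + 1)).
  have K1 : 0 < `|K| + 1 by rewrite ltr_wpDl.
  have d0 : 0 < d by rewrite lt_min r0 divr_gt0.
  apply/near0_boxP; exists d => // h k hd kd.
  have -> : (H \o shift p - (cst (H p) + linear_form A B)) (h, k) =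
      H (p.1 + h, p.2 + k) - H p - (A * h + B * k).
    rewrite -[LHS]/(H ((h, k) + p) - (H p + linear_form A B (h, k))).
    by rewrite /linear_form /= [_ + p]addrC opprD addrA; case: (p).
  have hr : `|h| < r by apply: (lt_le_trans hd); rewrite ge_min lexx.
  have kr : `|k| < r by apply: (lt_le_trans kd); rewrite ge_min lexx.
  apply: (le_trans (HK _ _ hr kr)); rewrite prod_normE /=.
  set m := Num.max _ _; have m0 : 0 <= m by rewrite le_max normr_ge0.
  have md : m <= e / (`|K| + 1).
    by apply/ltW; apply: (@lt_le_trans _ _ d); rewrite ?gt_max ?hd // ge_min lexx orbT.
  rewrite expr2 mulrA ler_wpM2r //.
  apply: (@le_trans _ _ ((`|K| + 1) * m)).
    by rewrite ler_wpM2r // (le_trans (ler_norm _)) // lerDl.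
  by rewrite mulrC -ler_pdivlMr.
have dE := diff_unique (@continuous_linear_form A B) lit.
apply: DiffDef => //; apply/diff_locallyP; rewrite dE; split => //.
exact: continuous_linear_form.
Qed.

Lemma pseries2_origin c : pseries2 c (0, 0) = c 0%N 0%N.
Proof.
rewrite /pseries2; have [|_ ->] := @tsum_seq _ _ (monomials c 0 0) [:: (0, 0)%N] isT.
  move=> [i j]; rewrite inE xpair_eqE negb_and /monomials /= => /orP[i0|j0].
    by rewrite expr0n (negPf i0) mulr0 mul0r.
  by rewrite [0 ^+ j]expr0n (negPf j0) mulr0.
by rewrite big_seq1 /monomials /= !mulr1.
Qed.

(** If the increment has maximum norm [m <= s], a monomial of degree at least 2 is at most
    [(m / s) ^+ 2] times its absolute value at [(s, s)]. The remainder after the linear part is thus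
    quadratic in [m]. *)
Lemma taylor_is_diff d H (p : R * R) (r : R) : 0 < r ->
  (forall h k, `|h| < r -> `|k| < r ->
     abs_summable (monomials d h k) /\ H (p.1 + h, p.2 + k) = pseries2 d (h, k)) ->
  is_diff p H (linear_form (d 1%N 0%N) (d 0%N 1%N)).
Proof.
move=> r0 Hd; pose s := r / 2.
have s0 : 0 < s by rewrite divr_gt0.
have sr : `|s| < r by rewrite gtr0_norm // /s; lra.
have [ss _] := Hd s s sr sr.
pose K := tsum (fun q => `|monomials d s s q|) / s ^+ 2.
apply: (@is_diff_quadratic _ _ _ _ K s) => // h k hs ks.
have hr : `|h| < r by rewrite (lt_trans hs) // -(gtr0_norm s0).
have kr : `|k| < r by rewrite (lt_trans ks) // -(gtr0_norm s0).
have [shk ->] := Hd h k hr kr.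
have -> : H p = d 0%N 0%N.
  have [||_] := Hd 0 0; rewrite ?normr0 // !addr0 -surjective_pairing => ->.
  exact: pseries2_origin.
pose low : nat * nat -> R := fun q => if q \in [:: (0, 0); (1, 0); (0, 1)]%N
  then monomials d h k q else 0.
have [|slow lowE] := @tsum_seq _ _ low [:: (0, 0); (1, 0); (0, 1)]%N isT.
  by move=> q; rewrite /low => /negPf ->.
have -> : pseries2 d (h, k) - d 0%N 0%N - (d 1%N 0%N * h + d 0%N 1%N * k) =
    tsum (fun q => monomials d h k q - low q).
  rewrite tsumD //; last exact: abs_summableN.
  rewrite tsumN lowE !big_cons big_nil /low /monomials /pseries2 /=.
  by ring.
set m := Num.max _ _; have m0 : 0 <= m by rewrite le_max normr_ge0.
have ms : m / s <= 1 by rewrite ler_pdivrMr // mul1r ge_max !ltW.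
have shi : abs_summable (fun q => monomials d h k q - low q).
  by apply: abs_summableD => //; exact: abs_summableN.
apply: (le_trans (ler_norm_tsum shi)).
have -> : K * m ^+ 2 = tsum (fun q => (m / s) ^+ 2 * `|monomials d s s q|).
  rewrite tsumZ; last exact: abs_summable_norm.
  by rewrite /K; field; exact: lt0r_neq0.
apply: le_tsum; first exact: abs_summable_norm.
  exact/abs_summableZ/abs_summable_norm.
move=> [i j]; rewrite /low; case: ifPn => hij.
  by rewrite subrr normr0 mulr_ge0 ?sqr_ge0.
rewrite subr0 /monomials /= !normrM !normrX (gtr0_norm s0).
rewrite -[leLHS]mulrA -[_ * s ^+ i * s ^+ j]mulrA [leRHS]mulrCA ler_wpM2l //.
have hm : `|h| <= m by rewrite le_max lexx.
have km : `|k| <= m by rewrite le_max lexx orbT.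
apply: (@le_trans _ _ (m ^+ (i + j))).
  by rewrite exprD ler_pM ?exprn_ge0 // lerXn2r.
have ij2 : (2 <= i + j)%N.
  by move: hij; rewrite !inE !xpair_eqE; case: i => [|[|i]]; case: j => [|[|j]].
have -> : (m / s) ^+ 2 * (s ^+ i * s ^+ j) = m ^+ 2 * s ^+ (i + j - 2).
  rewrite -exprD -[in LHS](subnK ij2) exprD expr_div_n; field.
  exact: lt0r_neq0.
rewrite -{1}(subnKC ij2) exprD ler_wpM2l ?sqr_ge0 // lerXn2r ?nnegrE // ?ltW //.
by rewrite /m gt_max hs.
Qed.

Lemma is_diff_derive H (p : R * R) (A B : R) : is_diff p H (linear_form A B) ->
  'D_((1, 0) : R * R) H p = A /\ 'D_((0, 1) : R * R) H p = B.
Proof.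
move=> [dH dE]; rewrite !deriveE // dE /linear_form /=; split; ring.
Qed.

Lemma near_pseries2_analytic c : geo_bounded c ->
  \forall p \near ((0, 0) : R * R), analytic_at (pseries2 c) p.
Proof.
move=> [C [M [C0 M1 cM]]]; have M0 : 0 < M by lra.
have r0 : 0 < (4 * M)^-1 by rewrite invr_gt0 mulr_gt0.
apply/near0_boxP; exists (4 * M)^-1 => // x y xr yr.
exists (taylor2 c (x, y)), (4 * M)^-1; split => // h k hr kr.
by apply/abs_sums_toP; have [] := taylor2P C0 M1 cM (p := (x, y)) xr yr hr kr.
Qed.

Lemma near_pseries2_is_diff c : geo_bounded c ->
  \forall p \near ((0, 0) : R * R),
    is_diff p (pseries2 c) (linear_form (pseries2 (dx c) p) (pseries2 (dy c) p)).
Proof.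
move=> [C [M [C0 M1 cM]]]; have M0 : 0 < M by lra.
have r0 : 0 < (4 * M)^-1 by rewrite invr_gt0 mulr_gt0.
apply/near0_boxP; exists (4 * M)^-1 => // x y xr yr.
rewrite -(taylor2_10 c) -taylor2_01; apply: taylor_is_diff r0 _ => h k hr kr.
by have [] := taylor2P C0 M1 cM (p := (x, y)) xr yr hr kr.
Qed.

Lemma analytic_at0P H : analytic_at H (0, 0) ->
  exists2 c, geo_bounded c & \forall p \near ((0, 0) : R * R), H p = pseries2 c p.
Proof.
move=> [c [r [r0 Hc]]]; exists c.
  have r2 : `|r / 2| < r by rewrite gtr0_norm ?divr_gt0 //; lra.
  apply: (@geo_bounded_summable _ _ (r / 2)); first by rewrite divr_gt0.
  by have /abs_sums_toP[] := Hc _ _ r2 r2.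
apply/near0_boxP; exists r => // x y xr yr.
by have /abs_sums_toP[_] := Hc _ _ xr yr; rewrite /= !add0r => <-.
Qed.

(** Each coefficient is, up to a nonzero factor, the constant term of an iterated derivative, and
    the derivatives of a locally vanishing series vanish locally. *)
Lemma pseries2_identity c : geo_bounded c ->
  (\forall p \near ((0, 0) : R * R), pseries2 c p = 0) ->
  forall i j, c i j = 0.
Proof.
have step d : geo_bounded d -> (\forall p \near ((0, 0) : R * R), pseries2 d p = 0) ->
    (\forall p \near ((0, 0) : R * R), pseries2 (dx d) p = 0) /\
    (\forall p \near ((0, 0) : R * R), pseries2 (dy d) p = 0).
  move=> gd d0; have gd' := near_pseries2_is_diff gd.
  (* Differentiating at [p] requires the series to vanish around [p], not only at [p]. *)
  have d0' := near_join d0.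
  have h : \forall p \near ((0, 0) : R * R), pseries2 (dx d) p = 0 /\ pseries2 (dy d) p = 0.
    move: gd' d0'; set O : R * R := (0, 0) => gd' d0'.
    near=> p.
    have [<- <-] : 'D_((1, 0) : R * R) (pseries2 d) p = pseries2 (dx d) p /\
        'D_((0, 1) : R * R) (pseries2 d) p = pseries2 (dy d) p.
      by apply: is_diff_derive; near: p.
    have e0 : \forall q \near p, pseries2 d q = cst 0 q by near: p.
    by rewrite !(near_eq_derive _ e0) !derive_cst.
  by split; apply: filterS h => p [].
move=> gc c0 i j; elim: i j c gc c0 => [|i IHi]; last first.
  move=> j c gc c0; have [cx0 _] := step c gc c0.
  have /eqP := IHi j _ (geo_bounded_dx gc) cx0.
  by rewrite /dx mulf_eq0 pnatr_eq0 /= => /eqP.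
elim=> [|j IHj] c gc c0; first by rewrite -pseries2_origin; exact: nbhs_singleton c0.
have [_ cy0] := step c gc c0.
have /eqP := IHj _ (geo_bounded_dy gc) cy0.
by rewrite /dy mulf_eq0 pnatr_eq0 /= => /eqP.
Unshelve. all: by end_near. Qed.

Lemma near_pseries2_sum n (F : nat -> nat -> nat -> R) :
  (forall k, geo_bounded (F k)) ->
  \forall p \near ((0, 0) : R * R),
    pseries2 (fun i j => \sum_(k < n) F k i j) p = \sum_(k < n) pseries2 (F k) p.
Proof.
move=> gF; elim: n => [|n IH].
  have -> : (fun i j => \sum_(k < 0) F k i j) = fun _ _ => 0.
    by apply/funext => i; apply/funext => j; rewrite big_ord0.
  by apply/near0_boxP; exists 1 => // x y _ _; rewrite big_ord0 pseries2_0.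
have -> : (fun i j => \sum_(k < n.+1) F k i j) = fun i j => \sum_(k < n) F k i j + F n i j.
  by apply/funext => i; apply/funext => j; rewrite big_ord_recr.
have s1 := near_abs_summable (geo_bounded_sum n gF).
have s2 := near_abs_summable (gF n).
by apply: filterS3 IH s1 s2 => p IH s1 s2; rewrite big_ord_recr /= -IH pseries2D.
Qed.

Lemma geo_bounded_lie D e c : geo_bounded c -> geo_bounded (lie_coef D e c).
Proof.
move=> gc; have gx := geo_bounded_dx gc; have gy := geo_bounded_dy gc.
rewrite /lie_coef; apply: geo_boundedD.
  apply: (@geo_bounded_sum _ D (fun k i j => \sum_(l < D) e k l * shift_coef k l (dx c) i j)) => k.
  apply: (@geo_bounded_sum _ D (fun l i j => e k l * shift_coef k l (dx c) i j)) => l.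
  exact/geo_boundedZ/geo_bounded_shift.
have -> : (fun i j => - (2 * shift_coef 3 0 (dy c) i j)) =
    fun i j => - 2 * shift_coef 3 0 (dy c) i j.
  by apply/funext => i; apply/funext => j; rewrite mulNr.
exact/geo_boundedZ/geo_bounded_shift.
Qed.

(** Dictionary between the recurrence on coefficients and the partial differential equation.
    Necessity combines it with the identity theorem; sufficiency reads it at a zero array. *)
Lemma near_pseries2_lie D e c : geo_bounded c ->
  \forall p \near ((0, 0) : R * R),
    pseries2 (lie_coef D e c) p =
    (\sum_(k < D) \sum_(l < D) e k l * p.1 ^+ k * p.2 ^+ l) * 'D_((1, 0) : R * R) (pseries2 c) p
    - 2 * p.1 ^+ 3 * 'D_((0, 1) : R * R) (pseries2 c) p.
Proof.
move=> gc; have gx := geo_bounded_dx gc; have gy := geo_bounded_dy gc.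
pose F k l i j := e k l * shift_coef k l (dx c) i j.
have gF k l : geo_bounded (F k l) by exact/geo_boundedZ/geo_bounded_shift.
have gF' k : geo_bounded (fun i j => \sum_(l < D) F k l i j) by exact: geo_bounded_sum.
have gy' : geo_bounded (fun i j => - 2 * shift_coef 3 0 (dy c) i j).
  exact/geo_boundedZ/geo_bounded_shift.
have s1 := near_abs_summable (geo_bounded_sum D gF').
have s2 := near_abs_summable gy'.
have s4 := near_abs_summable gx.
have s5 := near_abs_summable gy.
have e1 := near_pseries2_sum D gF'.
have e2 : \forall p \near ((0, 0) : R * R), forall k : 'I_D,
    pseries2 (fun i j => \sum_(l < D) F k l i j) p = \sum_(l < D) pseries2 (F k l) p.
  apply: (filter_forall (nbhs_filter ((0, 0) : R * R))) => k.
  by have h := near_pseries2_sum D (gF k); exact h.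
have dc := near_pseries2_is_diff gc.
move: s1 s2 s4 s5 e1 e2 dc; set O : R * R := (0, 0).
move=> s1 s2 s4 s5 e1 e2 dc; have lieE : lie_coef D e c = fun i j => \sum_(k < D) \sum_(l < D) F k l i j
    + - 2 * shift_coef 3 0 (dy c) i j.
  by apply/funext => i; apply/funext => j; rewrite /lie_coef mulNr.
near=> p.
have [-> ->] : 'D_((1, 0) : R * R) (pseries2 c) p = pseries2 (dx c) p /\
    'D_((0, 1) : R * R) (pseries2 c) p = pseries2 (dy c) p.
  by apply: is_diff_derive; near: p.
rewrite lieE pseries2D; try by near: p.
rewrite (near e1 p) // pseries2Z; last by apply: abs_summable_shift; near: p.
rewrite pseries2_shift; last by near: p.
rewrite expr0 mulr1 mulNr mulrA; congr (_ - _).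
rewrite mulr_suml; apply: eq_bigr => k _.
rewrite (near e2 p) // mulr_suml; apply: eq_bigr => l _.
rewrite /F pseries2Z; last by apply: abs_summable_shift; near: p.
by rewrite pseries2_shift ?mulrA //; near: p.
Unshelve. all: by end_near. Qed.

End AnalyticDerivatives.

(** * Necessity *)

Section NilpotentCoefficients.
Context {R : realType}.
Variables (n : nat) (a : nat -> nat -> R).

Definition xdot_coef (k l : nat) : R :=
  if (k == 0%N) && (l == 1%N) then 1
  else if (k + l == 3)%N || (k + l == 2 * n + 3)%N then a k l else 0.

Lemma sum_antidiagonal D m (F : nat -> nat -> R) : (m < D)%N ->
  \sum_(k < D) \sum_(l < D) (if (k + l == m)%N then F k l else 0) =
  \sum_(k < m.+1) F k (m - k)%N.
Proof.
move=> mD; rewrite (big_ord_widen D (fun k => F k (m - k)%N) mD) [RHS]big_mkcond.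
apply: eq_bigr => k _; case: ifPn => km.
  have lD : (m - k < D)%N by lia.
  rewrite (bigD1 (Ordinal lD)) //= subnKC // eqxx big1 ?addr0 // => l lne.
  by case: eqP => // kl; case/eqP: lne; apply: val_inj => /=; lia.
by rewrite big1 // => l _; case: eqP => // kl; lia.
Qed.

(** Positivity of [n] separates the degrees 3 and [2 * n + 3]: for [n = 0] the system would count
    the cubic terms twice, [xdot_coef] once. *)
Lemma xdot_coefE D (x y : R) : (0 < n)%N -> (2 * n + 3 < D)%N ->
  \sum_(k < D) \sum_(l < D) xdot_coef k l * x ^+ k * y ^+ l =
  y + a 3%N 0%N * x ^+ 3 + a 2%N 1%N * x ^+ 2 * y + a 1%N 2%N * x * y ^+ 2
  + a 0%N 3%N * y ^+ 3
  + \sum_(i < (2 * n + 3).+1) a i (2 * n + 3 - i)%N * x ^+ i * y ^+ (2 * n + 3 - i).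
Proof.
move=> n0 nD.
pose F k l := a k l * x ^+ k * y ^+ l.
have lin : \sum_(k < D) \sum_(l < D) (if (val k == 0)%N && (val l == 1)%N then y else 0 : R) = y.
  have D0 : (0 < D)%N by lia.
  have D1 : (1 < D)%N by lia.
  rewrite (bigD1 (Ordinal D0)) //= [X in _ + X]big1 ?addr0; last first.
    move=> k k0; rewrite big1 // => l _.
    by case: eqP => // k0'; case/eqP: k0; exact: val_inj.
  rewrite (bigD1 (Ordinal D1)) //= big1 ?addr0 // => l l1.
  by case: eqP => // l1'; case/eqP: l1; exact: val_inj.
rewrite -(sum_antidiagonal F nD).
have cubic : \sum_(k < D) \sum_(l < D) (if (k + l == 3)%N then F k l else 0) =
    a 3%N 0%N * x ^+ 3 + a 2%N 1%N * x ^+ 2 * y + a 1%N 2%N * x * y ^+ 2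
    + a 0%N 3%N * y ^+ 3.
  by rewrite sum_antidiagonal ?big_ord_recl ?big_ord0 /F /=; [ring|lia].
transitivity (\sum_(k < D) \sum_(l < D) ((if (val k == 0)%N && (val l == 1)%N then y else 0)
    + (if (k + l == 3)%N then F k l else 0)
    + (if (k + l == 2 * n + 3)%N then F k l else 0))).
  apply: eq_bigr => -[k kD] _; apply: eq_bigr => -[l lD] _ /=; rewrite /xdot_coef /F.
  case: ifPn => [/andP[/eqP -> /eqP ->]|_].
    by rewrite [_ == (2 * n + 3)%N]eq_sym addn3 /= !addr0 !mul1r.
  have [->|_] := eqVneq (k + l)%N 3%N.
    have -> : (3 == 2 * n + 3)%N = false by apply/eqP; lia.
    by rewrite /= add0r addr0.
  by case: eqP => _ /=; rewrite ?mul0r ?add0r.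
under eq_bigr => k _ do rewrite !big_split /=.
by rewrite !big_split /= lin cubic; ring.
Qed.

Lemma nilpotent_systemE D (p : R * R) : (0 < n)%N -> (2 * n + 3 < D)%N ->
  nilpotent_system n a p =
  (\sum_(k < D) \sum_(l < D) xdot_coef k l * p.1 ^+ k * p.2 ^+ l, - (2 * p.1 ^+ 3)).
Proof. by case: p => x y n0 nD; rewrite xdot_coefE // /nilpotent_system /= mulNr. Qed.

Lemma analytic_first_integral_coef H : (1 < n)%N ->
  analytic_first_integral (nilpotent_system n a) H ->
  forall k l, odd k -> xdot_coef k l = 0.
Proof.
move=> n1 [anH XH ncH].
pose D := (2 * n + 4)%N; have nD : (2 * n + 3 < D)%N by rewrite /D; lia.
have [c gc Hc] := analytic_at0P (nbhs_singleton anH).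
have lie0 : \forall p \near ((0, 0) : R * R), pseries2 (lie_coef D xdot_coef c) p = 0.
  have lc := near_pseries2_lie D xdot_coef gc.
  apply: filterS3 XH (near_join Hc) lc => p; rewrite (@nilpotent_systemE D) //; last lia.
  by move=> XHp Hp ->; rewrite -!(near_eq_derive _ Hp) -mulNr.
have lieE := pseries2_identity (geo_bounded_lie D xdot_coef gc) lie0.
have low k l : (D <= k)%N || (D <= l)%N -> xdot_coef k l = 0.
  move=> kl; rewrite /xdot_coef /D in kl *; case: ifP => [|_]; first by lia.
  by case: ifP => //; lia.
have coef0 : forall k l, (k < D)%N -> (l < D)%N -> odd k -> xdot_coef k l = 0.
  apply: (@formal_first_integral_even _ D xdot_coef c) => //.
  - by rewrite /D; lia.
  - move=> k l; rewrite /xdot_coef; case: ifP => [|_]; first by lia.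
    by case: ifP => [|_]; [lia|rewrite eqxx].
  - move=> k l; rewrite /xdot_coef xpair_eqE => + /negPf h; rewrite h.
    by case: ifP => [|_]; [lia|rewrite eqxx].
  (* As [k + 2 * l = 2 * (k + l) - k], weights within one degree are distinct; [1 < n] separates the
     two degrees. *)
  - move=> k l k' l' ko ko'; rewrite /xdot_coef.
    case: ifP => [|_]; first by lia.
    case: ifP => [kl _|_]; last by rewrite eqxx.
    case: ifP => [|_]; first by lia.
    by case: ifP => [kl' _|_]; [lia|rewrite eqxx].
  (* A series reduced to its constant term would make [H] constant near the origin. *)
  apply: contrapT => c0; apply: ncH.
  have cE : c = fun i j => if (i == 0)%N && (j == 0)%N then c 0%N 0%N else 0.
    apply/funext => i; apply/funext => j; case: ifP => [/andP[/eqP -> /eqP ->] //|ij].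
    apply/eqP; apply: contraT => cij; case: c0; exists i, j; split => //.
    by case: i j ij {cij} => [|i] [|j].
  have H0 := nbhs_singleton Hc.
  by apply: filterS Hc => p ->; rewrite H0 cE !pseries2_const.
move=> k l ko; case: (ltnP k D) => kD; last by rewrite low // kD.
by case: (ltnP l D) => lD; [exact: coef0|rewrite low // lD orbT].
Qed.

Lemma odd_xdot_coef0 : (1 < n)%N -> (forall k l, odd k -> xdot_coef k l = 0) <->
  (a 3%N 0%N = 0 /\ a 1%N 2%N = 0 /\
   forall k : nat, (k <= n + 1)%N -> a (2 * n + 3 - 2 * k)%N (2 * k)%N = 0).
Proof.
move=> n1; split=> [h|[h30 [h12 h]] k l ko].
  split; first by rewrite -(h 3%N 0%N).
  split; first by rewrite -(h 1%N 2%N).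
  move=> k kn; rewrite -(h (2 * n + 3 - 2 * k)%N (2 * k)%N); last by lia.
  rewrite /xdot_coef; case: ifP => [|_]; first by lia.
  by case: ifP => //; lia.
rewrite /xdot_coef; case: ifP => [|_]; first by lia.
case: ifP => // /orP[kl|kl].
  have [[-> ->]|[-> ->]] // : (k = 3 /\ l = 0 \/ k = 1 /\ l = 2)%N by lia.
have -> : (l = 2 * l./2)%N by lia.
have -> : (k = 2 * n + 3 - 2 * l./2)%N by lia.
by apply: h; lia.
Qed.

End NilpotentCoefficients.

(** * Ordinary differential equations *)

Section RealDerivatives.
Context {R : realType}.
Implicit Types f g : R -> R.

Lemma is_derive_sub f g (x df dg : R) : is_derive x 1 f df -> is_derive x 1 g dg ->
  is_derive x 1 (fun t => f t - g t) (df - dg).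
Proof. by move=> Hf Hg; exact: is_deriveB. Qed.

Lemma is_derive_continuous f (x df : R) : is_derive x 1 f df -> {for x, continuous f}.
Proof.
by move=> [Hf _]; apply: differentiable_continuous; apply/derivable1_diffP.
Qed.

Lemma is_derive_MVT f (df : R -> R) (a b : R) : a <= b ->
  (forall x, a <= x <= b -> is_derive x 1 f (df x)) ->
  exists2 c, a <= c <= b & f b - f a = df c * (b - a).
Proof.
move=> ab fd; have [||c cab ->] := @MVT_segment R f df a b ab.
- by move=> x; rewrite in_itv /= => /andP[/ltW ax /ltW xb]; apply: fd; rewrite ax.
- apply: derivable_within_continuous => x; rewrite in_itv /= => axb.
  by have [] := fd x axb.
by exists c => //; move: cab; rewrite in_itv.
Qed.

Lemma derive_ge0_le f (df : R -> R) (a b : R) : a <= b ->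
  (forall x, a <= x <= b -> is_derive x 1 f (df x)) ->
  (forall x, a <= x <= b -> 0 <= df x) -> f a <= f b.
Proof.
move=> ab fd df0; have [c cab E] := is_derive_MVT ab fd.
by rewrite -subr_ge0 E mulr_ge0 ?df0 // subr_ge0.
Qed.

Lemma derive0_eq f (a b : R) : a <= b ->
  (forall x, a <= x <= b -> is_derive x 1 f 0) -> f a = f b.
Proof.
move=> ab fd; have [c cab] := is_derive_MVT ab fd.
by rewrite mul0r => /eqP; rewrite subr_eq0 => /eqP.
Qed.

Lemma is_derive_reflect f (x df : R) (b : R) : is_derive (b - x) 1 f df ->
  is_derive x 1 (fun t => f (b - t)) (- df).
Proof.
move=> fd; rewrite -mulrN1.
apply: (@is_derive1_comp _ f (fun t => b - t)) => //.
by rewrite -[- 1]add0r; apply: is_derive_sub.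
Qed.

(** Integrating from [- N] and subtracting the value at 0 lets the fundamental theorem serve
    negative arguments too. As [N] varies with the point, independence of [N] is needed to
    differentiate. *)
Lemma antiderivative f : continuous f ->
  exists F : R -> R, F 0 = 0 /\ forall x : R, is_derive x (1 : R) F (f x).
Proof.
move=> cf; pose G (N x : R) : R := (\int[lebesgue_measure]_(t in `[- N, x]) f t)%R.
have Gd (N x : R) : - N < x -> is_derive x 1 (G N) (f x).
  move=> Nx; have xx : x < x + 1 by rewrite ltrDl.
  have intf : lebesgue_measure.-integrable `[- N, x + 1] (EFin \o f).
    apply: continuous_compact_integrable; first exact: segment_compact.
    exact: continuous_subspaceT.
  have [dG eG] := continuous_FTC1_closed xx intf Nx (cf x).
  by apply: DeriveDef => //; rewrite -derive1E.
pose F x := G (`|x| + 1) x - G (`|x| + 1) 0.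
have FE (N x : R) : `|x| < N -> F x = G N x - G N 0.
  have indep (N1 N2 y : R) : `|y| < N1 -> `|y| < N2 ->
      G N1 y - G N1 0 = G N2 y - G N2 0.
    move=> y1 y2; suff : G N1 y - G N2 y = G N1 0 - G N2 0 by lra.
    have d (z : R) : `|z| <= `|y| -> is_derive z (1 : R) (fun t => G N1 t - G N2 t) 0.
      move=> zy; rewrite -(subrr (f z)); apply: is_derive_sub; apply: Gd.
        by have := ler_norm (- z); rewrite normrN; lra.
      by have := ler_norm (- z); rewrite normrN; lra.
    case: (leP 0 y) => y0.
      apply/esym/(@derive0_eq (fun t => G N1 t - G N2 t)) => // z /andP[z0 zy].
      by apply: d; rewrite !ger0_norm //; lra.
    apply/(@derive0_eq (fun t => G N1 t - G N2 t)); first exact: ltW.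
    by move=> z /andP[z0 zy]; apply: d; rewrite !ler0_norm //; lra.
  by move=> xN; apply: indep => //; rewrite ltrDl.
exists F; split; first by rewrite /F subrr.
move=> x; pose N := `|x| + 1.
have near_x : \forall y \near x, G N y - G N 0 = F y.
  have : \forall y \near x, `|x - y| < 1 by apply/nbhs_normP; exists 1 => /=; rewrite ?ltr01 // => y.
  apply: filterS => y xy; apply/esym/FE.
  have -> : y = x - (x - y) by ring.
  by apply: (le_lt_trans (ler_normB _ _)); rewrite ltrD2l.
apply: near_eq_is_derive near_x _; rewrite -(subr0 (f x)).
apply: is_derive_sub.
by apply: Gd; rewrite /N; have := ler_norm (- x); rewrite normrN; lra.
Qed.

Lemma is_derive_expRM (L x : R) : is_derive x 1 (fun t => expR (L * t)) (L * expR (L * x)).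
Proof.
rewrite mulrC.
suff : is_derive x 1 (fun t => L * t) L.
  exact: (@is_derive1_comp _ expR (fun t => L * t) x _ _ (is_derive_expR _)).
by have := is_deriveZ L (is_derive_id x (1 : R)); rewrite /GRing.scale /= mulr1.
Qed.

(* Integrating a bound by [L * C * expR (2 * L * t)] halves the constant: this is
   what makes Picard's operator a contraction on the whole line. *)
Lemma derive_exp_bound f (df : R -> R) (L C : R) : 0 < L -> 0 <= C -> f 0 = 0 ->
  (forall t : R, is_derive t (1 : R) f (df t)) ->
  (forall t, `|df t| <= L * C * expR (2 * L * `|t|)) ->
  forall t, `|f t| <= C / 2 * expR (2 * L * `|t|).
Proof.
move=> L0 C0.
have bound (g dg : R -> R) t : 0 <= t -> g 0 = 0 -> (forall s : R, is_derive s (1 : R) g (dg s)) ->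
    (forall s, `|dg s| <= L * C * expR (2 * L * `|s|)) ->
    g t <= C / 2 * expR (2 * L * t).
  move=> t0 g0 gd dgb; rewrite -subr_ge0.
  apply: (@le_trans _ _ (C / 2 * expR (2 * L * 0) - g 0)).
    by rewrite g0 subr0 mulr_ge0 ?expR_ge0 ?divr_ge0.
  apply: (@derive_ge0_le (fun t => C / 2 * expR (2 * L * t) - g t)
    (fun t => C / 2 * (2 * L * expR (2 * L * t)) - dg t)) => // s /andP[s0 st].
    apply: is_derive_sub => //; exact: is_deriveZ (is_derive_expRM _ _).
  have := dgb s; rewrite (ger0_norm s0) => h; have := ler_norm (dg s).
  have -> : C / 2 * (2 * L * expR (2 * L * s)) = L * C * expR (2 * L * s) by field.
  by lra.
have abs_bound (g dg : R -> R) t : 0 <= t -> g 0 = 0 -> (forall s : R, is_derive s (1 : R) g (dg s)) ->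
    (forall s, `|dg s| <= L * C * expR (2 * L * `|s|)) ->
    `|g t| <= C / 2 * expR (2 * L * t).
  move=> t0 g0 gd dgb; rewrite ler_norml; apply/andP; split; last exact: bound gd dgb.
  rewrite lerNl; apply: (@bound (fun t => - g t) (fun t => - dg t)) => //.
  - by rewrite g0 oppr0.
  - by move=> s; rewrite normrN.
move=> f0 fd dfb t; case: (leP 0 t) => t0.
  by rewrite [in leRHS]ger0_norm //; exact: abs_bound fd dfb.
rewrite (ltr0_norm t0).
have t0' : 0 <= - t by rewrite oppr_ge0 ltW.
have ft s : is_derive s (1 : R) (fun u => f (0 - u)) (- df (0 - s)).
  exact: is_derive_reflect (fd _).
have dfs s : `|- df (0 - s)| <= L * C * expR (2 * L * `|s|).
  by rewrite sub0r normrN -[`|s|]normrN; exact: dfb.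
have := abs_bound _ _ _ t0' _ ft dfs; rewrite !sub0r opprK oppr0; exact.
Qed.

Lemma geometric_le0 (x A : R) : (forall k, x <= A * 2^-1 ^+ k) -> x <= 0.
Proof.
move=> xA; rewrite leNgt; apply/negP => x0.
have A0 : 0 < A by have := xA 0%N; rewrite expr0 mulr1; apply: lt_le_trans.
have [k hk] : exists k : nat, A / x < k%:R.
  by exists (Num.truncn (A / x)).+1; exact: truncnS_gt.
have := xA k; rewrite exprVn ler_pdivlMr ?exprn_gt0 // leNgt => /negP; apply.
rewrite mulrC -ltr_pdivrMr //; apply: (lt_le_trans hk).
by rewrite -natrX ler_nat ltnW // ltn_expl.
Qed.

(** The intervals of centre [u k] and radius [2 * A * 2^-1 ^+ k] are nested; the supremum of their
    left ends lies in all of them. *)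
Lemma geometric_cauchy (u : nat -> R) (A : R) :
  (forall k, `|u k.+1 - u k| <= A * 2^-1 ^+ k) ->
  exists l, forall k, `|u k - l| <= 2 * A * 2^-1 ^+ k.
Proof.
move=> uA; pose lo k := u k - 2 * A * 2^-1 ^+ k; pose hi k := u k + 2 * A * 2^-1 ^+ k.
have step k : lo k <= lo k.+1 /\ hi k.+1 <= hi k.
  have := uA k; rewrite ler_norml /lo /hi !exprS => /andP[h1 h2].
  by split; lra.
have lo_le k m : lo k <= lo (k + m)%N.
  by elim: m => [|m IH]; rewrite ?addn0 // addnS (le_trans IH) // (step _).1.
have hi_le k m : hi (k + m)%N <= hi k.
  by elim: m => [|m IH]; rewrite ?addn0 // addnS (le_trans _ IH) // (step _).2.
have A0 k : 0 <= A * 2^-1 ^+ k by rewrite (le_trans _ (uA k)).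
have lohi k m : lo k <= hi m.
  apply: (le_trans (lo_le k m)); apply: (@le_trans _ _ (hi (k + m)%N)).
    by rewrite /lo /hi; have := A0 (k + m)%N; lra.
  by rewrite addnC hi_le.
exists (sup [set lo k | k in [set: nat]]) => k.
have h1 : lo k <= sup [set lo k | k in [set: nat]].
  by apply: ub_le_sup; [exists (hi 0%N) => _ [m _ <-]|exists k].
have h2 : sup [set lo k | k in [set: nat]] <= hi k.
  by apply: ge_sup; [exists (lo 0%N), 0%N|move=> _ [m _ <-]].
by rewrite ler_norml; rewrite /lo /hi in h1 h2; apply/andP; split; lra.
Qed.

End RealDerivatives.

(** * Global solutions for a bounded Lipschitz field *)

Section Picard.
Context {R : realType}.

Definition maxdist (p q : R * R) : R := Num.max `|p.1 - q.1| `|p.2 - q.2|.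

Lemma maxdist_le p q (b : R) :
  (maxdist p q <= b) = (`|p.1 - q.1| <= b) && (`|p.2 - q.2| <= b).
Proof. by rewrite /maxdist ge_max. Qed.

Lemma maxdist_triangle p q r : maxdist p r <= maxdist p q + maxdist q r.
Proof.
rewrite maxdist_le; apply/andP; split.
  apply: (le_trans (ler_distD q.1 _ _)).
  by apply: lerD; rewrite /maxdist le_max lexx.
apply: (le_trans (ler_distD q.2 _ _)).
by apply: lerD; rewrite /maxdist le_max lexx orbT.
Qed.

Lemma maxdistC p q : maxdist p q = maxdist q p.
Proof. by rewrite /maxdist distrC [X in Num.max _ X]distrC. Qed.

Lemma maxdist_le0 p q : maxdist p q <= 0 -> p = q.
Proof.
rewrite maxdist_le !normr_le0 !subr_eq0 => /andP[/eqP e1 /eqP e2].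
by rewrite (surjective_pairing p) (surjective_pairing q) e1 e2.
Qed.

(** With [G := F \o phi] this is the differential equation itself; with [G := F \o psi] it makes
    [phi] a Picard iterate of [psi]. *)
Definition primitive_pair (G phi : R -> R * R) : Prop := forall t : R,
  is_derive t (1 : R) (fun s => (phi s).1) (G t).1 /\
  is_derive t (1 : R) (fun s => (phi s).2) (G t).2.

Lemma lipschitz_continuous1 (f : R -> R) (K : R) :
  (forall s t, `|f s - f t| <= K * `|s - t|) -> continuous f.
Proof.
move=> fK x; apply/cvgrPdist_le => e e0.
have K1 : 0 < `|K| + 1 by rewrite ltr_wpDl.
apply/nbhs_normP; exists (e / (`|K| + 1)) => /=; first by rewrite divr_gt0.
move=> y /= xy; apply: (le_trans (fK _ _)).
apply: (@le_trans _ _ ((`|K| + 1) * `|x - y|)).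
  by rewrite ler_wpM2r // (le_trans (ler_norm _)) // lerDl.
by rewrite mulrC -ler_pdivlMr // ltW.
Qed.

Variables (F : R * R -> R * R) (L B : R).
Hypothesis L0 : 0 < L.
Hypothesis B0 : 0 <= B.
Hypothesis F_lip : forall p q, maxdist (F p) (F q) <= L * maxdist p q.
Hypothesis F_bound : forall p, maxdist (F p) (0, 0) <= B.

(** Bielecki's weight for the Lipschitz constant [L]. *)
Let expw (t : R) := expR (2 * L * `|t|).

Let lipB (phi : R -> R * R) := forall s t, maxdist (phi s) (phi t) <= B * `|s - t|.

Let primitive_lip psi phi : primitive_pair (F \o psi) phi -> lipB phi.
Proof.
move=> dphi s t; wlog st : s t / t <= s => [H|].
  case: (leP t s) => [/H //|/ltW /H]; by rewrite maxdistC distrC.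
have bound (f : R -> R) (df : R -> R) : (forall x : R, is_derive x (1 : R) f (df x)) ->
    (forall x, `|df x| <= B) -> `|f s - f t| <= B * `|s - t|.
  move=> fd dfB; have [c _ ->] := is_derive_MVT st (fun x _ => fd x).
  by rewrite normrM ler_wpM2r.
rewrite maxdist_le; apply/andP; split.
  apply: (bound (fun x => (phi x).1) (fun x => (F (psi x)).1)) => x; first by have [] := dphi x.
  by have := F_bound (psi x); rewrite maxdist_le !subr0 => /andP[].
apply: (bound (fun x => (phi x).2) (fun x => (F (psi x)).2)) => x; first by have [] := dphi x.
by have := F_bound (psi x); rewrite maxdist_le !subr0 => /andP[].
Qed.

Let primitive_exists p psi : lipB psi ->
  exists phi, phi 0 = p /\ primitive_pair (F \o psi) phi.
Proof.
move=> psiB.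
have FpsiB s t : maxdist (F (psi s)) (F (psi t)) <= L * B * `|s - t|.
  by apply: (le_trans (F_lip _ _)); rewrite -mulrA ler_wpM2l // ltW.
have [G1 [G10 G1d]] : exists G : R -> R, G 0 = 0 /\
    forall x : R, is_derive x (1 : R) G (F (psi x)).1.
  apply: antiderivative; apply: (@lipschitz_continuous1 _ (L * B)) => s t.
  by have := FpsiB s t; rewrite maxdist_le => /andP[].
have [G2 [G20 G2d]] : exists G : R -> R, G 0 = 0 /\
    forall x : R, is_derive x (1 : R) G (F (psi x)).2.
  apply: antiderivative; apply: (@lipschitz_continuous1 _ (L * B)) => s t.
  by have := FpsiB s t; rewrite maxdist_le => /andP[].
exists (fun t => (G1 t - - p.1, G2 t - - p.2)); split.
  by rewrite G10 G20 !sub0r !opprK; case: (p).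
move=> t /=; split.
  by rewrite -(subr0 (F (psi t)).1); apply: is_derive_sub.
by rewrite -(subr0 (F (psi t)).2); apply: is_derive_sub.
Qed.

Let pair_exp_bound G G' phi phi' (C : R) : 0 <= C -> phi 0 = phi' 0 ->
  primitive_pair G phi -> primitive_pair G' phi' ->
  (forall t, maxdist (G t) (G' t) <= L * C * expw t) ->
  forall t, maxdist (phi t) (phi' t) <= C / 2 * expw t.
Proof.
move=> C0 e0 dphi dphi' GG' t; rewrite maxdist_le; apply/andP; split.
  apply: (@derive_exp_bound _ (fun t => (phi t).1 - (phi' t).1)
    (fun t => (G t).1 - (G' t).1)) => //.
  - by rewrite e0 subrr.
  - by move=> s; apply: is_derive_sub; [case: (dphi s)|case: (dphi' s)].
  - by move=> s; have := GG' s; rewrite maxdist_le => /andP[].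
apply: (@derive_exp_bound _ (fun t => (phi t).2 - (phi' t).2)
    (fun t => (G t).2 - (G' t).2)) => //.
- by rewrite e0 subrr.
- by move=> s; apply: is_derive_sub; [case: (dphi s)|case: (dphi' s)].
- by move=> s; have := GG' s; rewrite maxdist_le => /andP[].
Qed.

Let contraction psi psi' phi phi' (C : R) : 0 <= C -> phi 0 = phi' 0 ->
  primitive_pair (F \o psi) phi -> primitive_pair (F \o psi') phi' ->
  (forall t, maxdist (psi t) (psi' t) <= C * expw t) ->
  forall t, maxdist (phi t) (phi' t) <= C / 2 * expw t.
Proof.
move=> C0 e0 dphi dphi' hC; apply: (pair_exp_bound C0 e0 dphi dphi') => t /=.
by apply: (le_trans (F_lip _ _)); rewrite -mulrA ler_wpM2l // ltW.
Qed.

(** Derivatives bounded by [B] differ by at most [2 * B], that is [L] times [2 * (B / L)], and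
    integration halves this constant. The alternatives serve existence, which starts from a constant
    path, and uniqueness, which compares two solutions. *)
Let initial_bound psi phi phi' : phi 0 = phi' 0 ->
  primitive_pair (F \o psi) phi ->
  primitive_pair (fun=> (0, 0)) phi' \/ (exists psi', primitive_pair (F \o psi') phi') ->
  forall t, maxdist (phi t) (phi' t) <= B / L * expw t.
Proof.
move=> e0 dphi dphi' t.
have LB : L * (2 * (B / L)) = 2 * B.
  by field; exact: lt0r_neq0.
have expw1 s : 1 <= expw s.
  by rewrite /expw -expR0 ler_expR !mulr_ge0 // ltW.
have bnd s : 2 * B <= L * (2 * (B / L)) * expw s.
  by rewrite LB ler_peMr ?mulr_ge0.
have -> : B / L * expw t = 2 * (B / L) / 2 * expw t by field; exact: lt0r_neq0.
have C0 : 0 <= 2 * (B / L) by rewrite mulr_ge0 ?divr_ge0 // ltW.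
case: dphi' => [dphi'|[psi' dphi']]; apply: (pair_exp_bound C0 e0 dphi dphi') => s.
  apply: le_trans (bnd s); apply: (le_trans (F_bound _)).
  by rewrite ler_peMl // ler1n.
apply: le_trans (bnd s); apply: (le_trans (maxdist_triangle _ (0, 0) _)).
rewrite [maxdist _ (F _)]maxdistC (_ : 2 * B = B + B); last by ring.
by apply: lerD; exact: F_bound.
Qed.

Theorem ode_unique phi psi : phi 0 = psi 0 ->
  primitive_pair (F \o phi) phi -> primitive_pair (F \o psi) psi -> phi = psi.
Proof.
move=> e0 dphi dpsi; apply/funext => t; apply: maxdist_le0.
apply: (@geometric_le0 _ _ (B / L * expw t)) => k.
have C0 j : 0 <= B / L * 2^-1 ^+ j :> R by rewrite mulr_ge0 ?divr_ge0 ?exprn_ge0 // ltW.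
rewrite mulrAC; elim: k t => [|k IH] t.
  rewrite expr0 mulr1; apply: (initial_bound e0 dphi).
  by right; exists psi.
rewrite exprS [2^-1 * _]mulrC mulrA.
exact: (contraction (C0 k) e0 dphi dpsi).
Qed.

Theorem ode_exists p : exists phi, phi 0 = p /\ primitive_pair (F \o phi) phi.
Proof.
(* Picard's operator; outside the Lipschitz paths its values are arbitrary. *)
have [P HP] : {P : (R -> R * R) -> R -> R * R | forall psi, lipB psi ->
    P psi 0 = p /\ primitive_pair (F \o psi) (P psi)}.
  have step psi : exists phi, lipB psi -> phi 0 = p /\ primitive_pair (F \o psi) phi.
    case: (pselect (lipB psi)) => [/(primitive_exists p)[phi hphi]|nlip].
      by exists phi.
    by exists psi => /nlip.
  by have [P HP] := choice step; exists P.
pose u k := iter k P (fun=> p).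
have ulip k : lipB (u k).
  elim: k => [|k IH]; last by have [_ /primitive_lip] := HP _ IH.
  by move=> s t; rewrite maxdist_le /= !subrr normr0 mulr_ge0.
have u0 k : u k 0 = p by case: k => [|k] //; have [] := HP _ (ulip k).
have du k : primitive_pair (F \o u k) (u k.+1) by have [] := HP _ (ulip k).
have C0 j : 0 <= B / L * 2^-1 ^+ j :> R by rewrite mulr_ge0 ?divr_ge0 ?exprn_ge0 // ltW.
have uu k : forall t, maxdist (u k.+1 t) (u k t) <= B / L * expw t * 2^-1 ^+ k.
  elim: k => [|k IH] t.
    rewrite expr0 mulr1; apply: (initial_bound _ (du 0%N)); first by rewrite !u0.
    by left=> s; split; exact: is_derive_cst.
  rewrite mulrAC exprS [2^-1 * _]mulrC mulrA.
  apply: (contraction (C0 k) _ (du k.+1) (du k)) => [|s]; first by rewrite !u0.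
  by rewrite mulrAC.
have /choice[phi phiP] : forall t, exists l : R * R, forall k,
    maxdist (u k t) l <= 2 * (B / L * expw t) * 2^-1 ^+ k.
  move=> t.
  have [l1 Hl1] : exists l1, forall k, `|(u k t).1 - l1| <= 2 * (B / L * expw t) * 2^-1 ^+ k.
    by apply: geometric_cauchy => k; have := uu k t; rewrite maxdist_le => /andP[].
  have [l2 Hl2] : exists l2, forall k, `|(u k t).2 - l2| <= 2 * (B / L * expw t) * 2^-1 ^+ k.
    by apply: geometric_cauchy => k; have := uu k t; rewrite maxdist_le => /andP[].
  by exists (l1, l2) => k; rewrite maxdist_le Hl1 Hl2.
have phi_lip : lipB phi.
  move=> s t; rewrite -subr_le0.
  apply: (@geometric_le0 _ _ (2 * (B / L * expw s) + 2 * (B / L * expw t))) => k.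
  rewrite lerBlDr mulrDl; apply: (le_trans (maxdist_triangle _ (u k s) _)).
  have := maxdist_triangle (u k s) (u k t) (phi t).
  have := ulip k s t; have := phiP s k; have := phiP t k.
  by rewrite [maxdist (phi s) _]maxdistC; lra.
have [psi0 dpsi] := HP _ phi_lip.
(* Both [P phi] and [phi] are within a multiple of [2^-1 ^+ k] of [u k.+1], by contraction and by
   convergence. *)
suff psiE : P phi = phi by exists phi; rewrite psiE in psi0 dpsi.
apply/funext => t; apply: maxdist_le0.
apply: (@geometric_le0 _ _ (2 * (B / L * expw t))) => k.
apply: (le_trans (maxdist_triangle _ (u k.+1 t) _)).
have C0' : 0 <= 2 * (B / L * 2^-1 ^+ k) by rewrite mulr_ge0.
have hk s : maxdist (phi s) (u k s) <= 2 * (B / L * 2^-1 ^+ k) * expw s.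
  have -> : 2 * (B / L * 2^-1 ^+ k) * expw s = 2 * (B / L * expw s) * 2^-1 ^+ k by ring.
  by rewrite maxdistC.
have := contraction C0' _ dpsi (du k) hk t; rewrite psi0 u0 => /(_ erefl) h1.
have := phiP t k.+1; rewrite exprS => h2.
apply: (le_trans (lerD h1 h2)); rewrite le_eqVlt; apply/orP; left; apply/eqP; field.
exact: lt0r_neq0.
Qed.

End Picard.

(** * An even first integral *)

Lemma bin_add_mono a b a' b' : (a <= a')%N -> (b <= b')%N ->
  ('C(a + b, a) <= 'C(a' + b', a'))%N.
Proof.
move=> aa bb; apply: (@leq_trans 'C(a + b', a)); first by rewrite leq_bin2l // leq_add2l.
rewrite -[in leqRHS]bin_sub ?leq_addr // addKn -[in leqLHS]bin_sub ?leq_addr // addKn.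
by rewrite leq_bin2l // leq_add2r.
Qed.

Lemma bin_le_exp2 n k : ('C(n, k) <= 2 ^ n)%N.
Proof.
elim: n k => [|n IH] [|k]; rewrite ?bin0 ?expn_gt0 //.
by rewrite binS expnS mul2n -addnn leq_add.
Qed.

Lemma sum_even {R : zmodType} (F : nat -> R) m : (forall k, odd k -> F k = 0) ->
  \sum_(k < 2 * m) F k = \sum_(k < m) F (2 * k)%N.
Proof.
move=> F0; elim: m => [|m IH]; first by rewrite muln0 !big_ord0.
rewrite [RHS]big_ord_recr /= -IH mulnS addnC addn2 2!big_ord_recr /=.
by rewrite (F0 (2 * m).+1) ?addr0 //; lia.
Qed.

Lemma sum_odd {R : zmodType} (F : nat -> R) m : (forall k, ~~ odd k -> F k = 0) ->
  \sum_(k < 2 * m) F k = \sum_(k < m) F (2 * k).+1.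
Proof.
move=> F0; elim: m => [|m IH]; first by rewrite muln0 !big_ord0.
rewrite [RHS]big_ord_recr /= -IH mulnS addnC addn2 2!big_ord_recr /=.
by rewrite (F0 (2 * m)%N) ?addr0 //; lia.
Qed.

(** * Majorants for the regular equation in the squared variables *)

Section RegularEquation.
Context {R : realType}.
Variables (m : nat) (f : nat -> nat -> R).
Hypothesis m0 : (0 < m)%N.
Hypothesis f00 : f 0%N 0%N = 1.
Implicit Type h : nat -> nat -> R.

Let tail h i j := \sum_(p : 'I_m * 'I_m | (val p.1, val p.2) != (0, 0)%N)
  f p.1 p.2 * shift_coef p.1 p.2 (dx h) i j.

(** The row [i = 0] is the initial datum [v]. In the other rows the equation is solved for its term
    of highest total degree, so only lower total degrees are read. *)
Let step h (i j : nat) : R := if i is i'.+1 then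
  (2 * shift_coef 1 0 (dy h) i' j - tail h i' j) / i%:R else (j == 1%N)%:R.

Let step_local h h' i j :
  (forall s t, (s + t < i + j)%N -> h s t = h' s t) -> step h i j = step h' i j.
Proof.
case: i => [//|i] hh; rewrite /step; congr (_ / _); congr (_ - _).
  rewrite /shift_coef /dy; case: ifP => // /andP[i0 _].
  by rewrite hh //; lia.
apply: eq_bigr => -[k l] /= kl; rewrite /shift_coef /dx; case: ifP => // /andP[ki lj].
rewrite hh //; have : (0 < k + l)%N by case: (val k) (val l) kl => [|?] [|?].
by lia.
Qed.

(** After [(i + j).+1] rounds the coefficients of total degree at most [i + j] no longer change. *)
Let h i j := iter (i + j).+1 step (fun _ _ => 0) i j.

Let iter_h N i j : (i + j < N)%N -> iter N step (fun _ _ => 0) i j = h i j.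
Proof.
suff H M M' s t : (s + t < M)%N -> (s + t < M')%N ->
    iter M step (fun _ _ => 0) s t = iter M' step (fun _ _ => 0) s t.
  by move=> ijN; apply: H.
elim: M M' s t => [//|M IH] [//|M'] s t sM sM' /=.
by apply: step_local => s' t' st; apply: IH; lia.
Qed.

Let h_step i j : h i j = step h i j.
Proof. by rewrite {1}/h /=; apply: step_local => s t st; rewrite iter_h. Qed.

Let h_eq i j : i.+1%:R * h i.+1 j =
  2 * shift_coef 1 0 (dy h) i j - tail h i j.
Proof. by rewrite h_step /step mulrC divfK // pnatr_eq0. Qed.

Let h0 j : h 0%N j = (j == 1%N)%:R. Proof. by rewrite h_step. Qed.

(** The summand 2 pays for [2 * u * dh/dv], the other one for the nonconstant terms of [f]; each
    total degree costs one factor [A]. *)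
Let A := 2 + \sum_(p : 'I_m * 'I_m) `|f p.1 p.2|.

Let A2 : 2 <= A. Proof. by rewrite /A lerDl sumr_ge0. Qed.

(* The binomial coefficient absorbs the factor [j + 1] lost by differentiating in
   [v]; it is the majorant [1 / (1 - A u - A v)]. *)
Let h_bound i j : `|h i j| <= 'C(i + j, i)%:R * A ^+ (i + j).
Proof.
have A2' := A2; have A1 : 1 <= A by lra.
have [N ijN] := ubnP (i + j)%N; elim: N i j ijN => [//|N IH] [|i] j ijN.
  rewrite h0 bin0 mul1r add0n; apply: (@le_trans _ _ 1); last exact: exprn_ege1.
  by case: eqP; rewrite ?normr1 ?normr0.
have i0 : 0 < i.+1%:R :> R by rewrite ltr0n.
rewrite -(ler_pM2l i0) -{1}(normr_nat R i.+1) -normrM h_eq.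
pose W : R := i.+1%:R * ('C(i.+1 + j, i.+1)%:R * A ^+ (i + j)).
have W0 : 0 <= W by rewrite !mulr_ge0 ?exprn_ge0 //; lra.
have t1 : `|2 * shift_coef 1 0 (dy h) i j| <= 2 * W.
  rewrite normrM (ger0_norm (ler0n R 2)) ler_wpM2l //.
  rewrite /shift_coef; case: ifP => [/andP[i1 _]|_]; last by rewrite normr0.
  case: i i1 ijN @W W0 {i0} => [//|i] _ ijN W W0; rewrite /dy subn1 subn0 /=.
  rewrite normrM normr_nat.
  apply: (@le_trans _ _ (j.+1%:R * ('C(i + j.+1, i)%:R * A ^+ (i + j.+1)))).
    by rewrite ler_wpM2l // IH //; lia.
  rewrite /W addnS -addSn !mulrA ler_wpM2r ?exprn_ge0 //; first lra.
  rewrite -!natrM ler_nat.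
  have -> : (j.+1 * 'C(i.+1 + j, i) = i.+1 * 'C(i.+1 + j, i.+1))%N.
    rewrite -[in LHS]bin_sub; last by lia.
    rewrite (_ : (i.+1 + j - i = j.+1)%N); last by lia.
    rewrite mul_bin_left (_ : (i.+1 + j - j = i.+1)%N); last by lia.
    by rewrite -[in RHS]bin_sub ?leq_addr // addKn.
  by apply: leq_mul => //; apply: bin_add_mono.
have t2 : `|tail h i j| <= (\sum_(p : 'I_m * 'I_m) `|f p.1 p.2|) * W.
  apply: (le_trans (ler_norm_sum _ _ _)); rewrite mulr_suml.
  rewrite [leRHS](bigID (fun p : 'I_m * 'I_m => (val p.1, val p.2) != (0, 0)%N)) /=.
  rewrite -[leLHS]addr0 lerD //; last by apply: sumr_ge0 => p _; rewrite mulr_ge0.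
  apply: ler_sum => -[k l] /= kl; rewrite normrM ler_wpM2l //.
  rewrite /shift_coef /dx; case: ifP => [/andP[ki lj]|_]; last by rewrite normr0.
  have kl0 : (0 < k + l)%N by case: (val k) (val l) kl => [|?] [|?].
  rewrite normrM normr_nat; apply: ler_pM => //; first by rewrite ler_nat ltnS leq_subr.
  apply: (@le_trans _ _ ('C((i - k).+1 + (j - l), (i - k).+1)%:R * A ^+ ((i - k).+1 + (j - l)))).
    by apply: IH; lia.
  apply: ler_pM => //; first by rewrite exprn_ge0 //; lra.
    by rewrite ler_nat; apply: bin_add_mono; lia.
  by apply: ler_weXn2l => //; lia.
apply: (le_trans (ler_normB _ _)); apply: (le_trans (lerD t1 t2)).
by rewrite -mulrDl -/A /W addSn exprS le_eqVlt; apply/predU1P; left; ring.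
Qed.

(** The right-hand side [2 * u * dh/dv] is divisible by [u] and [f] is invertible, so [dh/du]
    vanishes on [u = 0]. *)
Let h1 j : h 1%N j = 0.
Proof.
elim/ltn_ind: j => j IH; have := h_eq 0 j; rewrite mul1r => ->.
rewrite /shift_coef /= mulr0 /tail big1 ?subr0 // => -[k l] /= kl.
rewrite /shift_coef /dx; case: ifP => [/andP[]|_]; last by rewrite mulr0.
rewrite leqn0 => /eqP k0 lj; rewrite k0 subn0 IH ?mulr0 //.
by case: (val l) lj kl => [|l'] lj; rewrite k0 //; lia.
Qed.

Let h20 : h 2%N 0%N = 1.
Proof.
have := h_eq 1 0; rewrite /shift_coef /= /dy h0 mul1r /tail big1 ?subr0 => [|[k l] /= kl].
  by move=> /eqP; rewrite -subr_eq0 -mulrBr mulf_eq0 pnatr_eq0 subr_eq0 => /eqP.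
rewrite /shift_coef /dx; case: ifP => [/andP[]|_]; last by rewrite mulr0.
rewrite leqn0 => k1 /eqP l0; move: kl k1; rewrite l0 sub0n.
by case: (val k) => [|[|?]] // _ _; rewrite subnn h1 !mulr0.
Qed.

(* In the variables [u = x ^+ 2] and [v = y ^+ 2] the equation for first integrals
   becomes [(\sum f k l * u ^+ k * v ^+ l) * dh/du = 2 * u * dh/dv]; it is solved in
   powers of [u] from [h (0, v) = v], and [h = v + u ^+ 2 * (1 + o(1))]. *)
Lemma regular_equation_solution : exists h : nat -> nat -> R,
  [/\ forall i j, \sum_(k < m) \sum_(l < m) f k l * shift_coef k l (dx h) i j =
        2 * shift_coef 1 0 (dy h) i j,
      exists M, 1 <= M /\ forall i j, `|h i j| <= M ^+ (i + j),
      forall j, h 0%N j = (j == 1%N)%:R, forall j, h 1%N j = 0 & h 2%N 0%N = 1].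
Proof.
exists h; split=> //.
  move=> i j; rewrite pair_big /= (bigD1 (Ordinal m0, Ordinal m0)) //= f00 mul1r.
  rewrite [X in X + _](_ : _ = i.+1%:R * h i.+1 j); last first.
    by rewrite /shift_coef /= !subn0.
  rewrite h_eq /tail -addrA [X in _ + X](_ : _ = 0) ?addr0 //.
  apply/eqP; rewrite addrC subr_eq0; apply/eqP; apply: eq_bigl => -[[k hk] [l hl]] /=.
  by rewrite xpair_eqE -!val_eqE.
exists (2 * A); split; first by have := A2; lra.
move=> i j; apply: (le_trans (h_bound i j)); rewrite exprMn.
have A1 := A2; apply: ler_pM => //; first by rewrite exprn_ge0 //; lra.
by rewrite -natrX ler_nat bin_le_exp2.
Qed.

End RegularEquation.

Section EvenFirstIntegral.
Context {R : realType}.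
Variables (m : nat) (e : nat -> nat -> R).
Hypothesis m0 : (0 < m)%N.
Hypothesis e01 : e 0%N 1%N = 1.
Hypothesis e_even : forall k l, e k l != 0 -> ~~ odd k && odd l.

(** The coefficients are those of [h (x ^+ 2, y ^+ 2)]. The equation at
    [x ^+ (2 * i).+1 * y ^+ (2 * j).+1] is twice the regular equation at [u ^+ i * v ^+ j];
    elsewhere all terms vanish by parity. *)
Lemma even_first_integral_coef : exists c : nat -> nat -> R,
  [/\ geo_bounded c, forall i j, lie_coef (2 * m) e c i j = 0,
      forall q, c 0%N q = (q == 2%N)%:R,
      forall p q, (0 < p < 4)%N -> c p q = 0 & c 4%N 0%N = 1].
Proof.
have [h [h_eq [M [M1 hM]] h0 h1 h20]] :=
  @regular_equation_solution R m (fun k l => e (2 * k)%N (2 * l).+1) m0 e01.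
pose c p q := if odd p || odd q then 0 else h p./2 q./2.
have c2 i j : c (2 * i)%N (2 * j)%N = h i j.
  rewrite /c !oddM /= [(2 * i)%N]mulnC [(2 * j)%N]mulnC !muln2 !doubleK //.
exists c; split.
- exists 1, M; split => // i j; rewrite mul1r /c; case: ifP => _.
    by rewrite normr0 exprn_ge0 //; lra.
  by apply: (le_trans (hM _ _)); apply: ler_weXn2l => //; lia.
- move=> i j; rewrite /lie_coef.
  have [/andP[io jo]|ij] := boolP (odd i && odd j); last first.
    rewrite big1 => [|k _].
      rewrite sub0r /shift_coef /dy; case: ifP => [/andP[i3 _]|_]; last by rewrite mulr0 oppr0.
      rewrite /c (_ : odd (i - 3) || odd (j - 0).+1) ?mulr0 ?oppr0 //.
      by apply: contraNT ij => *; lia.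
    rewrite big1 // => l _; have [->|ekl] := eqVneq (e k l) 0; first by rewrite mul0r.
    have /andP[ke lo] := e_even ekl.
    rewrite /shift_coef /dx; case: ifP => [/andP[ki lj]|_]; last by rewrite mulr0.
    rewrite /c (_ : odd (i - k).+1 || odd (j - l)) ?mulr0 //.
    by apply: contraNT ij => *; lia.
  have [i' ->] : exists i', i = (2 * i').+1 by exists i./2; lia.
  have [j' ->] : exists j', j = (2 * j').+1 by exists j./2; lia.
  have sdx k l : shift_coef (2 * k) (2 * l).+1 (dx c) (2 * i').+1 (2 * j').+1 =
      2 * shift_coef k l (dx h) i' j'.
    rewrite /shift_coef /dx.
    have -> : ((2 * k <= (2 * i').+1) && ((2 * l).+1 <= (2 * j').+1) =
      (k <= i') && (l <= j'))%N by lia.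
    case: ifP => [/andP[ki lj]|_]; last by rewrite mulr0.
    have -> : ((2 * i').+1 - 2 * k).+1 = (2 * (i' - k).+1)%N by lia.
    have -> : ((2 * j').+1 - (2 * l).+1 = 2 * (j' - l))%N by lia.
    by rewrite c2 natrM mulrA.
  have sdy : shift_coef 3 0 (dy c) (2 * i').+1 (2 * j').+1 =
      2 * shift_coef 1 0 (dy h) i' j'.
    rewrite /shift_coef /dy.
    have -> : ((3 <= (2 * i').+1) && (0 <= (2 * j').+1) = (1 <= i') && (0 <= j'))%N by lia.
    case: ifP => [/andP[ki lj]|_]; last by rewrite mulr0.
    have -> : ((2 * i').+1 - 3 = 2 * (i' - 1))%N by lia.
    have -> : ((2 * j').+1 - 0).+1 = (2 * (j' - 0).+1)%N by lia.
    by rewrite c2 natrM mulrA.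
  rewrite sdy -h_eq mulr_sumr.
  rewrite (@sum_even _ (fun k => \sum_(l < 2 * m)
      e k l * shift_coef k l (dx c) (2 * i').+1 (2 * j').+1)); last first.
    move=> k ko; rewrite big1 // => l _; have [->|/e_even] := eqVneq (e k l) 0.
      by rewrite mul0r.
    by rewrite ko.
  apply/eqP; rewrite subr_eq0; apply/eqP; apply: eq_bigr => k _.
  rewrite mulr_sumr (@sum_odd _ (fun l =>
      e (2 * k)%N l * shift_coef (2 * k) l (dx c) (2 * i').+1 (2 * j').+1)).
    by apply: eq_bigr => l _; rewrite sdx; ring.
  move=> l lo; have [->|/e_even] := eqVneq (e (2 * k)%N l) 0; first by rewrite mul0r.
  by rewrite (negPf lo) andbF.
- move=> q; rewrite /c /=; case: ifP => qo.
    by case: eqP qo => [->|].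
  rewrite h0; congr (_ %:R); have -> : (q./2 == 1)%N = (q == 2)%N by lia.
  by [].
- move=> p q p4; rewrite /c; case: ifP => // /negbT pq.
  by rewrite (_ : p./2 = 1%N) ?h1 //; lia.
by rewrite (c2 2%N 0%N).
Qed.

End EvenFirstIntegral.

(** * Reversible centers *)

Section BoundedLipschitz.
Context {R : realType}.

(** Boundedness makes products Lipschitz again, and therefore polynomials in the truncated
    coordinates. *)
Definition bounded_lipschitz (f : R * R -> R) : Prop := exists K : R,
  [/\ 0 <= K, forall p, `|f p| <= K & forall p q, `|f p - f q| <= K * maxdist p q].

Lemma maxdist_ge0 (p q : R * R) : 0 <= maxdist p q.
Proof. by rewrite /maxdist le_max normr_ge0. Qed.

Lemma bounded_lipschitz_cst (b : R) : bounded_lipschitz (fun=> b).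
Proof.
exists `|b|; split => // p q; by rewrite subrr normr0 mulr_ge0 // maxdist_ge0.
Qed.

Lemma bounded_lipschitzD f g : bounded_lipschitz f -> bounded_lipschitz g ->
  bounded_lipschitz (fun p => f p + g p).
Proof.
move=> [K [K0 fK fL]] [M [M0 gM gL]]; exists (K + M); split => [|p|p q].
- exact: addr_ge0.
- by rewrite (le_trans (ler_normD _ _)) // lerD.
- by rewrite opprD addrACA mulrDl (le_trans (ler_normD _ _)) // lerD.
Qed.

Lemma bounded_lipschitzM f g : bounded_lipschitz f -> bounded_lipschitz g ->
  bounded_lipschitz (fun p => f p * g p).
Proof.
move=> [K [K0 fK fL]] [M [M0 gM gL]]; exists (K * M + K * M); split => [|p|p q].
- by rewrite addr_ge0 ?mulr_ge0.
- rewrite normrM (@le_trans _ _ (K * M)) ?lerDl ?mulr_ge0 //; exact: ler_pM.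
have -> : f p * g p - f q * g q = f p * (g p - g q) + (f p - f q) * g q by ring.
rewrite (le_trans (ler_normD _ _)) // !normrM mulrDl lerD //.
  by rewrite -mulrA ler_pM.
by rewrite mulrAC ler_pM.
Qed.

Lemma bounded_lipschitzX f k : bounded_lipschitz f -> bounded_lipschitz (fun p => f p ^+ k).
Proof.
move=> Hf; elim: k => [|k IH]; first exact: bounded_lipschitz_cst.
have -> : (fun p => f p ^+ k.+1) = fun p => f p * f p ^+ k.
  by apply/funext => p; rewrite exprS.
exact: bounded_lipschitzM.
Qed.

Lemma bounded_lipschitz_sum D (f : nat -> R * R -> R) : (forall k, bounded_lipschitz (f k)) ->
  bounded_lipschitz (fun p => \sum_(k < D) f k p).
Proof.
move=> Hf; elim: D => [|D IH].
  have -> : (fun p => \sum_(k < 0) f k p) = fun=> 0.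
    by apply/funext => p; rewrite big_ord0.
  exact: bounded_lipschitz_cst.
have -> : (fun p => \sum_(k < D.+1) f k p) = fun p => \sum_(k < D) f k p + f D p.
  by apply/funext => p; rewrite big_ord_recr.
exact: bounded_lipschitzD.
Qed.

Definition clip (z : R) : R := Num.max (- 1) (Num.min z 1).

Lemma clip_cases z : [\/ z < - 1 /\ clip z = - 1, - 1 <= z <= 1 /\ clip z = z
  | 1 < z /\ clip z = 1].
Proof.
rewrite /clip; case: (leP z 1) => z1.
  case: (leP (- 1) z) => z2; first by constructor 2.
  by constructor 1.
by constructor 3; rewrite max_r //; lra.
Qed.

Lemma clipN z : clip (- z) = - clip z.
Proof.
by case: (clip_cases z) => -[z1 ->]; case: (clip_cases (- z)) => -[z2 ->]; lra.
Qed.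

Lemma clip_id z : `|z| <= 1 -> clip z = z.
Proof. by rewrite ler_norml /clip => /andP[z1 z2]; rewrite min_l // max_r. Qed.

Lemma norm_clip z : `|clip z| <= 1.
Proof.
by rewrite ler_norml /clip le_max lexx ge_max ge_min lexx orbT andbT /=; lra.
Qed.

Lemma clip_lip z w : `|clip z - clip w| <= `|z - w|.
Proof.
wlog wz : z w / w <= z => [H|].
  by case: (leP w z) => [/H //|/ltW /H]; rewrite distrC [leRHS]distrC.
rewrite (ger0_norm (_ : 0 <= z - w)) ?subr_ge0 //.
by case: (clip_cases z) => -[z1 ->]; case: (clip_cases w) => -[w1 ->];
  rewrite ler_norml; apply/andP; split; lra.
Qed.

Definition clip2 (p : R * R) : R * R := (clip p.1, clip p.2).

Lemma bounded_lipschitz_clip1 : bounded_lipschitz (fun p => (clip2 p).1).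
Proof.
exists 1; split => [||p q]; [exact: ler01|by move=> p; exact: norm_clip|].
by rewrite mul1r (le_trans (clip_lip _ _)) // /maxdist le_max lexx.
Qed.

Lemma bounded_lipschitz_clip2 : bounded_lipschitz (fun p => (clip2 p).2).
Proof.
exists 1; split => [||p q]; [exact: ler01|by move=> p; exact: norm_clip|].
by rewrite mul1r (le_trans (clip_lip _ _)) // /maxdist le_max lexx orbT.
Qed.

End BoundedLipschitz.

Section DerivativeTools.
Context {R : realType}.

Lemma is_derive_shift (g : R -> R) (b x d : R) : is_derive (b + x) 1 g d ->
  is_derive x 1 (fun t => g (b + t)) d.
Proof.
move=> gd.
have h : is_derive x 1 (fun t => g (b - (0 - t))) (- - d).
  apply: (@is_derive_reflect _ (fun t => g (b - t))).
  by apply: is_derive_reflect; rewrite sub0r opprK.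
rewrite opprK in h.
have -> : (fun t => g (b + t)) = fun t => g (b - (0 - t)).
  by apply/funext => t; rewrite sub0r opprK.
exact: h.
Qed.

Lemma is_derive_pairP (phi : R -> R * R) (t d1 d2 : R) :
  is_derive t (1 : R) (fun s => (phi s).1) d1 -> is_derive t (1 : R) (fun s => (phi s).2) d2 ->
  is_derive t (1 : R) phi (d1, d2).
Proof.
move=> [p1 e1] [p2 e2].
have D1 := (derivable1_diffP _ _).1 p1; have D2 := (derivable1_diffP _ _).1 p2.
have phiE : phi = fun s => ((phi s).1, (phi s).2) by apply/funext => s; case: (phi s).
have D : differentiable phi t by rewrite phiE; exact: differentiable_pair.
apply: DeriveDef; first exact/derivable1_diffP.
by rewrite deriveE // {1}phiE diff_pair // -!deriveE // e1 e2.
Qed.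

Lemma is_derive_chain2 (H : R * R -> R) (phi : R -> R * R) (t A B d1 d2 : R) :
  is_diff (phi t) H (linear_form A B) ->
  is_derive t (1 : R) (fun s => (phi s).1) d1 -> is_derive t (1 : R) (fun s => (phi s).2) d2 ->
  is_derive t (1 : R) (H \o phi) (A * d1 + B * d2).
Proof.
move=> [dH eH] h1 h2; have [pphi ephi] := is_derive_pairP h1 h2.
have Dphi := (derivable1_diffP _ _).1 pphi.
have D : differentiable (H \o phi) t by exact: differentiable_comp.
apply: DeriveDef; first exact/derivable1_diffP.
by rewrite deriveE // diff_comp //= eH -deriveE // ephi.
Qed.

Lemma nonzero_sign (y : R -> R) : continuous y -> (forall t, y t != 0) ->
  forall a b, 0 < y a -> 0 < y b.
Proof.
move=> cy y0 a b ya; rewrite ltNge; apply/negP => yb.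
have [c _ /eqP] : exists2 c, c \in `[Num.min a b, Num.max a b]%R & y c = 0.
  apply: IVT; first by rewrite ge_min le_max lexx.
    exact: continuous_subspaceT.
  case: (leP a b) => ab; rewrite ?(min_l ab) ?(max_r ab) ?(min_r (ltW ab)) ?(max_l (ltW ab)).
    by rewrite ge_min yb orbT le_max (ltW ya).
  by rewrite ge_min yb le_max (ltW ya) orbT.
exact/negP/y0.
Qed.

Lemma derive_ge_lin (g dg : R -> R) (m a b : R) : a <= b ->
  (forall x : R, is_derive x (1 : R) g (dg x)) ->
  (forall x, a <= x <= b -> m <= dg x) -> g a + m * (b - a) <= g b.
Proof.
move=> ab gd dgm; have [c cab E] := is_derive_MVT ab (fun x _ => gd x).
by rewrite addrC -lerBrDr E ler_wpM2r ?dgm // subr_ge0.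
Qed.

End DerivativeTools.

(** * Trapped orbits and their reflections *)

Section ReversibleCenter.
Context {R : realType}.
Variables (f H A B : R * R -> R) (r : R).
Let X (p : R * R) : R * R := (f p, - (2 * p.1 ^+ 3)).
Hypothesis f_lip : bounded_lipschitz (f \o clip2).
Hypothesis f_evenx : forall x y, f (- x, y) = f (x, y).
Hypothesis f_oddy : forall x y, f (x, - y) = - f (x, y).
Hypothesis r0 : 0 < r.
Hypothesis r1 : r <= 2^-1.
Hypothesis f_pos : forall x y, `|x| <= r -> `|y| <= r -> 0 < y -> y / 2 <= f (x, y).
Hypothesis H_diff : forall p, `|p.1| <= r -> `|p.2| <= r ->
  is_diff p H (linear_form (A p) (B p)).
Hypothesis H_first : forall p, `|p.1| <= r -> `|p.2| <= r ->
  f p * A p - 2 * p.1 ^+ 3 * B p = 0.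
Hypothesis H_low : forall x y, `|x| <= r -> `|y| <= r -> y ^+ 2 + x ^+ 4 / 2 <= H (x, y).
Hypothesis H_0 : H (0, 0) = 0.

(** On the boundary of the box [H] exceeds this level: it is at least [r ^+ 4 / 2] where [x] is
    extremal, and at least [r ^+ 2 >= 4 * r ^+ 4] where [y] is. *)
Let c0 := r ^+ 4 / 4.
Let U : set (R * R) := [set p | [/\ `|p.1| < r, `|p.2| < r & H p < c0]].

Let FX (p : R * R) : R * R := X (clip2 p).

Let FX_const : exists L K : R, [/\ 0 < L, 0 <= K,
  forall p q, maxdist (FX p) (FX q) <= L * maxdist p q & forall p, maxdist (FX p) (0, 0) <= K].
Proof.
have [K1 [K10 fK fL]] := f_lip.
have [K2 [K20 gK gL]] : bounded_lipschitz (fun p => - 2 * (clip2 p).1 ^+ 3 : R).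
  exact: bounded_lipschitzM (bounded_lipschitz_cst _) (bounded_lipschitzX 3 bounded_lipschitz_clip1).
exists (K1 + K2 + 1), (K1 + K2); split.
- by rewrite ltr_wpDl // addr_ge0.
- by rewrite addr_ge0.
- move=> p q; rewrite maxdist_le; apply/andP; split.
    apply: (le_trans (fL p q)); rewrite ler_wpM2r ?maxdist_ge0 //; lra.
  have := gL p q; rewrite !mulNr => h; apply: (le_trans h); rewrite ler_wpM2r ?maxdist_ge0 //; lra.
move=> p; rewrite maxdist_le /= !subr0; apply/andP; split.
  by apply: (le_trans (fK p)); lra.
by have := gK p; rewrite !mulNr => h; apply: (le_trans h); lra.
Qed.

Let flow_exists p : exists phi, phi 0 = p /\ primitive_pair (FX \o phi) phi.
Proof. by have [L [K [L0 K0 FL FK]]] := FX_const; exact: ode_exists L0 K0 FL FK p. Qed.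

Let flow_unique phi psi : phi 0 = psi 0 ->
  primitive_pair (FX \o phi) phi -> primitive_pair (FX \o psi) psi -> phi = psi.
Proof. by have [L [K [L0 K0 FL FK]]] := FX_const; exact: ode_unique L0 K0 FL FK _ _. Qed.

Let norm_le1 (x : R) : `|x| <= r -> `|x| <= 1.
Proof. by move=> xr; have := r1; lra. Qed.

Let FX_box p : `|p.1| <= r -> `|p.2| <= r -> FX p = X p.
Proof.
by move=> p1 p2; rewrite /FX /clip2 !clip_id ?norm_le1 // -surjective_pairing.
Qed.

Let FX_evenx x y : (FX (- x, y)).1 = (FX (x, y)).1 /\ (FX (- x, y)).2 = - (FX (x, y)).2.
Proof. by rewrite /FX /clip2 /= !clipN f_evenx; split; [|ring]. Qed.

Let FX_oddy x y : (FX (x, - y)).1 = - (FX (x, y)).1 /\ (FX (x, - y)).2 = (FX (x, y)).2.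
Proof. by rewrite /FX /clip2 /= !clipN f_oddy. Qed.

Let H_continuous p : `|p.1| <= r -> `|p.2| <= r -> {for p, continuous H}.
Proof. by move=> p1 p2; have [d _] := H_diff p1 p2; exact: differentiable_continuous. Qed.

Let boundary (x y : R) : `|x| <= r -> `|y| <= r -> H (x, y) < c0 -> `|x| < r /\ `|y| < r.
Proof.
move=> xr yr Hc; have low := H_low xr yr.
have r4 : 0 < r ^+ 4 by rewrite exprn_gt0.
have r42 : r ^+ 4 <= r ^+ 2 / 4.
  have e4 : r ^+ 4 = r ^+ 2 * r ^+ 2 by rewrite -exprD.
  rewrite e4 ler_wpM2l ?sqr_ge0 // (_ : 4^-1 = 2^-1 ^+ 2 :> R); last by field.
  by rewrite lerXn2r ?nnegrE ?invr_ge0 // ltW.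
have x4 : `|x| ^+ 4 = x ^+ 4 by rewrite -normrX ger0_norm // exprn_even_ge0.
have y2 : `|y| ^+ 2 = y ^+ 2 by rewrite -normrX ger0_norm // sqr_ge0.
have x40 : 0 <= x ^+ 4 by rewrite exprn_even_ge0.
have y20 : 0 <= y ^+ 2 by rewrite sqr_ge0.
rewrite /c0 in Hc.
rewrite !lt_neqAle xr yr !andbT; split; apply/eqP => E.
  by rewrite E in x4; rewrite -x4 in low; lra.
by rewrite E in y2; rewrite -y2 in low; lra.
Qed.

Let U_open : open U.
Proof.
rewrite openE => -[x y] [/= xr yr Hc]; rewrite /interior.
have c1 : \forall p \near (x, y), `|p.1| < r.
  by apply: (cvgr_norm_lt _ cvg_fst).
have c2 : \forall p \near (x, y), `|p.2| < r.
  by apply: (cvgr_norm_lt _ cvg_snd).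
have c3 : \forall p \near (x, y), H p < c0.
  by apply: (cvgr_lt _ (H_continuous (p := (x, y)) (ltW xr) (ltW yr))).
by apply: filterS3 c1 c2 c3 => p.
Qed.

Let H_gt0 p : `|p.1| <= r -> `|p.2| <= r -> p <> (0, 0) -> 0 < H p.
Proof.
case: p => x y /= xr yr p0; apply: lt_le_trans (H_low xr yr).
have x4 : 0 <= x ^+ 4 by rewrite exprn_even_ge0.
have y2 : 0 <= y ^+ 2 by rewrite sqr_ge0.
have [y0|y0] := eqVneq y 0.
  have x0 : x != 0 by apply/eqP => x0; apply: p0; rewrite x0 y0.
  have : 0 < x ^+ 4 by rewrite exprn_even_gt0.
  by lra.
have : 0 < y ^+ 2 by rewrite exprn_even_gt0.
by lra.
Qed.

(** Connectedness of the time line. The set of good times is open because [H] is constant along the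
    flow where the truncation is inactive; it is closed because, on the closed box, a level below
    [c0] forces the point into the interior. *)
Let trapped phi : U (phi 0) -> primitive_pair (FX \o phi) phi ->
  forall t, U (phi t) /\ H (phi t) = H (phi 0).
Proof.
move=> U0 dphi.
have cphi t : {for t, continuous phi}.
  have [d1 d2] := dphi t; have [d _] := is_derive_pairP d1 d2.
  exact/differentiable_continuous/derivable1_diffP.
pose S := [set t | U (phi t) /\ H (phi t) = H (phi 0)].
have S_open : open S.
  rewrite openE => t [Ut Ht]; rewrite /interior.
  have /nbhs_ballP[d /= d0 dU] : \forall s \near t, U (phi s).
    by apply: cphi; apply: open_nbhs_nbhs.
  apply/nbhs_ballP; exists d => // s ts; split; first exact: dU.
  rewrite -Ht.
  have dH u : `|t - u| < d -> is_derive u (1 : R) (H \o phi) 0.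
    move=> tu; have [u1 u2 _] : U (phi u) by apply: dU; rewrite /ball /=.
    have eF : (FX \o phi) u = X (phi u) by exact: FX_box (ltW u1) (ltW u2).
    have [d1 d2] := dphi u; rewrite eF /= in d1 d2.
    have := is_derive_chain2 (H_diff (ltW u1) (ltW u2)) d1 d2.
    suff -> : A (phi u) * f (phi u) + B (phi u) * - (2 * (phi u).1 ^+ 3) = 0 by [].
    by rewrite -(H_first (ltW u1) (ltW u2)); ring.
  have ts' : `|t - s| < d by move: ts; rewrite /ball /=.
  case: (leP t s) => st.
    apply/esym/(@derive0_eq _ (H \o phi)) => // u /andP[tu us].
    by apply: dH; move: ts'; rewrite !ler0_norm; lra.
  apply/(@derive0_eq _ (H \o phi)); first exact: ltW.
  by move=> u /andP[su ut]; apply: dH; move: ts'; rewrite !ger0_norm; lra.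
have S_closed : open (~` S).
  rewrite openE => t nSt; rewrite /interior.
  have [/is_derive_continuous cp1 /is_derive_continuous cp2] := dphi t.
  case: (leP `|(phi t).1| r) => p1; last first.
    have : \forall s \near t, r < `|(phi s).1|.
      exact: cvgr_norm_gt cp1 _ p1.
    by apply: filterS => s h [[h' _ _] _]; lra.
  case: (leP `|(phi t).2| r) => p2; last first.
    have : \forall s \near t, r < `|(phi s).2|.
      exact: cvgr_norm_gt cp2 _ p2.
    by apply: filterS => s h [[_ h' _] _]; lra.
  have cH : (H \o phi) s @[s --> t] --> H (phi t).
    exact: cvg_comp _ _ (cphi t) (H_continuous p1 p2).
  have Hne : H (phi t) != H (phi 0).
    apply/eqP => E; apply: nSt; have [_ _ Hc] := U0; split=> //.
    have hb : H ((phi t).1, (phi t).2) < c0 by rewrite -surjective_pairing E.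
    by have [h1 h2] := boundary p1 p2 hb; split; rewrite // E.
  have Hd : 0 < `|H (phi t) - H (phi 0)| by rewrite normr_gt0 subr_eq0.
  have : \forall s \near t, `|H (phi t) - (H \o phi) s| < `|H (phi t) - H (phi 0)|.
    by move/cvgrPdist_lt: cH; apply.
  by apply: filterS => s hs [_ h']; move: hs; rewrite /= h' ltxx.
suff SE : S = setT by move=> t; have : S t by rewrite SE.
have cT : connected [set: R] by apply/connected_intervalP.
apply: (cT S); first by exists 0.
  by exists S => //; rewrite setTI.
by exists S; rewrite ?setTI //; rewrite -openC.
Qed.

Let f_odd x y : f (- x, - y) = - f (x, y).
Proof. by rewrite f_evenx f_oddy. Qed.

Section Hitting.
Variables x y : R -> R.
Hypothesis dx : forall t : R, is_derive t (1 : R) x (f (x t, y t)).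
Hypothesis dy : forall t : R, is_derive t (1 : R) y (- (2 * x t ^+ 3)).
Hypothesis xr : forall t, `|x t| <= r.
Hypothesis yr : forall t, `|y t| <= r.

(* While [y > 0] the abscissa increases, so it stays away from [0] either in the
   future or in the past, where [y] then decreases at a definite rate. *)
Lemma hits_axis_of_pos : ~ (forall t, 0 < y t).
Proof.
move=> ypos.
have dxpos t : 0 < f (x t, y t).
  by apply: lt_le_trans (f_pos (xr t) (yr t) (ypos t)); rewrite divr_gt0.
have xmono s t : s <= t -> x s <= x t.
  move=> st; have := @derive_ge_lin _ x _ 0 s t st dx (fun u _ => ltW (dxpos u)).
  by rewrite mul0r addr0.
case: (leP 0 (x 0)) => x0.
  have x1 : 0 < x 1.
    have [c _ E] := is_derive_MVT ler01 (fun u _ => dx u).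
    have : 0 < x 1 - x 0 by rewrite E subr0 mulr1.
    by lra.
  pose d := 2 * x 1 ^+ 3; have d0 : 0 < d by rewrite mulr_gt0 ?exprn_gt0.
  pose T := 1 + y 1 / d.
  have T1 : 1 <= T by rewrite lerDl divr_ge0 // ltW.
  have := @derive_ge_lin _ (fun t => - y t) (fun t => - - (2 * x t ^+ 3)) d 1 T T1.
  have dy' u : is_derive u (1 : R) (fun t => - y t) (- - (2 * x u ^+ 3)).
    by have h := is_deriveN (dy u); exact h.
  move=> /(_ dy'); have bnd u : 1 <= u <= T -> d <= - - (2 * x u ^+ 3).
    move=> /andP[u1 _]; rewrite opprK ler_wpM2l // lerXn2r ?nnegrE //; first exact: ltW.
      by apply: le_trans (xmono _ _ u1); exact: ltW.
    exact: xmono.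
  move=> /(_ bnd); have -> : d * (T - 1) = y 1.
    by rewrite /T addrC addKr mulrC divfK // gt_eqF.
  by have := ypos T; lra.
pose d := 2 * (- x 0) ^+ 3; have d0 : 0 < d.
  by rewrite mulr_gt0 ?exprn_gt0 // oppr_gt0.
pose T := - (y 0 / d); have T0 : T <= 0 by rewrite oppr_le0 divr_ge0 // ltW.
have bnd u : T <= u <= 0 -> d <= - (2 * x u ^+ 3).
  move=> /andP[_ u0]; have xu := xmono _ _ u0.
  have -> : - (2 * x u ^+ 3) = 2 * (- x u) ^+ 3 by ring.
  by rewrite ler_wpM2l // lerXn2r ?nnegrE ?oppr_ge0 ?lerN2 //; lra.
have := @derive_ge_lin _ y _ d T 0 T0 dy bnd.
have -> : d * (0 - T) = y 0 by rewrite /T sub0r opprK mulrC divfK // gt_eqF.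
by have := ypos T; lra.
Qed.

(** After [t0] the ordinate is negative and decreasing, so by oddness of [f] in [y] the abscissa
    falls at a rate bounded below. *)
Lemma hits_second_axis_of_pos t0 : y t0 = 0 -> ~ (forall t, 0 < x t).
Proof.
move=> yt0 xpos.
have dyneg t : - (2 * x t ^+ 3) < 0 by rewrite oppr_lt0 mulr_gt0 ?exprn_gt0.
have dy' u : is_derive u (1 : R) (fun t => - y t) (- - (2 * x u ^+ 3)).
  by have h := is_deriveN (dy u); exact h.
have dyge u : 0 <= - - (2 * x u ^+ 3) by rewrite oppr_ge0 ltW.
have ymono s t : s <= t -> y t <= y s.
  move=> st; have := @derive_ge_lin _ (fun t => - y t) _ 0 s t st dy' (fun u _ => dyge u).
  by rewrite mul0r addr0 lerN2.
pose t1 := t0 + 1; have t01 : t0 <= t1 by rewrite lerDl.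
have y1 : y t1 < 0.
  have [c _ E] := is_derive_MVT t01 (fun u _ => dy u).
  have : y t1 - y t0 < 0 by rewrite E /t1 addrC addKr mulr1.
  by lra.
pose d := - y t1 / 2; have d0 : 0 < d by rewrite divr_gt0 // oppr_gt0.
(* By the instant [T], a fall at rate [d] has used up [x t1]. *)
pose T := t1 + x t1 / d.
have T1 : t1 <= T by rewrite lerDl divr_ge0 // ltW.
have dx' u : is_derive u (1 : R) (fun t => - x t) (- f (x u, y u)).
  by have h := is_deriveN (dx u); exact h.
have bnd u : t1 <= u <= T -> d <= - f (x u, y u).
  move=> /andP[u1 _]; rewrite -f_oddy; have yu := ymono _ _ u1.
  apply: (@le_trans _ _ (- y u / 2)); first by rewrite /d; lra.
  by apply: f_pos; rewrite ?normrN //; lra.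
have := @derive_ge_lin _ (fun t => - x t) _ d t1 T T1 dx' bnd.
have -> : d * (T - t1) = x t1 by rewrite /T addrC addKr mulrC divfK // gt_eqF.
by have := xpos T; lra.
Qed.

End Hitting.

Section Orbit.
Variables x y : R -> R.
Hypothesis dx : forall t : R, is_derive t (1 : R) x (f (x t, y t)).
Hypothesis dy : forall t : R, is_derive t (1 : R) y (- (2 * x t ^+ 3)).
Hypothesis xr : forall t, `|x t| <= r.
Hypothesis yr : forall t, `|y t| <= r.

(** The half turn [(x, y) -> (- x, - y)] preserves the field without reversing time, which reduces
    negative signs to positive ones. *)
Let dxN t : is_derive t (1 : R) (fun s => - x s) (f (- x t, - y t)).
Proof. by rewrite f_odd; have h := is_deriveN (dx t); exact h. Qed.

Let dyN t : is_derive t (1 : R) (fun s => - y s) (- (2 * (- x t) ^+ 3)).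
Proof.
have -> : - (2 * (- x t) ^+ 3) = - - (2 * x t ^+ 3) by ring.
by have h := is_deriveN (dy t); exact h.
Qed.

Let opp_continuous (g : R -> R) : continuous g -> continuous (fun t => - g t).
Proof. by move=> cg t; apply: cvgN; exact: cg. Qed.

Lemma hits_first_axis : exists t, y t = 0.
Proof.
have cy : continuous y by move=> t; exact: is_derive_continuous (dy t).
apply: contrapT => ny; have y0 t : y t != 0 by apply/eqP => yt; apply: ny; exists t.
case: (ltP 0 (y 0)) => y00.
  by apply: (hits_axis_of_pos dx dy xr yr) => t; exact: nonzero_sign cy y0 _ _ y00.
apply: (hits_axis_of_pos dxN dyN) => t; rewrite ?normrN //.
apply: (nonzero_sign (opp_continuous cy) _ (a := 0)) => [s|].
  by rewrite oppr_eq0.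
by rewrite oppr_gt0 lt_neqAle y0.
Qed.

Lemma hits_second_axis t0 : y t0 = 0 -> exists t, x t = 0.
Proof.
move=> yt0; have cx : continuous x by move=> t; exact: is_derive_continuous (dx t).
apply: contrapT => nx; have x0 t : x t != 0 by apply/eqP => xt; apply: nx; exists t.
case: (ltP 0 (x 0)) => x00.
  by apply: (hits_second_axis_of_pos dx dy xr yr yt0) => t; exact: nonzero_sign cx x0 _ _ x00.
have yt0N : - y t0 = 0 by rewrite yt0 oppr0.
apply: (hits_second_axis_of_pos dxN dyN _ _ yt0N) => t; rewrite ?normrN //.
apply: (nonzero_sign (opp_continuous cx) _ (a := 0)) => [s|].
  by rewrite oppr_eq0.
by rewrite oppr_gt0 lt_neqAle x0.
Qed.

End Orbit.

(* Composing the reflections about the two instants at which the orbit meets the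
   axes gives the half turn [phi (t + 2 * s) = - phi t]. *)
Let half_turn phi t0 t1 : primitive_pair (FX \o phi) phi ->
  (phi t0).2 = 0 -> (phi t1).1 = 0 ->
  forall t, phi (t + 2 * (t1 - t0)) = (- (phi t).1, - (phi t).2).
Proof.
move=> dphi y0 x1.
have shift b : primitive_pair (FX \o (fun t => phi (b + t))) (fun t => phi (b + t)).
  move=> t; have [d1 d2] := dphi (b + t); split.
    exact: (@is_derive_shift _ (fun s => (phi s).1)).
  exact: (@is_derive_shift _ (fun s => (phi s).2)).
have reflect b t : is_derive t (1 : R) (fun s => (phi (b - s)).1) (- (FX (phi (b - t))).1) /\
    is_derive t (1 : R) (fun s => (phi (b - s)).2) (- (FX (phi (b - t))).2).
  have [d1 d2] := dphi (b - t); split.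
    exact: (@is_derive_reflect _ (fun s => (phi s).1)).
  exact: (@is_derive_reflect _ (fun s => (phi s).2)).
have refl_y t : phi (t0 + t) = ((phi (t0 - t)).1, - (phi (t0 - t)).2).
  pose psi t := ((phi (t0 - t)).1, - (phi (t0 - t)).2).
  suff : (fun t => phi (t0 + t)) = psi by move/(congr1 (fun g => g t)).
  apply: flow_unique; first by rewrite /psi !subr0 y0 oppr0 addr0 -y0 -surjective_pairing.
    exact: shift.
  move=> s; have [d1 d2] := reflect t0 s.
  have [e1 e2] := FX_oddy (phi (t0 - s)).1 (phi (t0 - s)).2.
  have -> : (FX \o psi) s = (- (FX (phi (t0 - s))).1, (FX (phi (t0 - s))).2).
    by rewrite /comp /psi [LHS]surjective_pairing e1 e2 -surjective_pairing.
  split; first exact d1.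
  by have h := is_deriveN d2; rewrite opprK in h; exact h.
have refl_x t : phi (t1 + t) = (- (phi (t1 - t)).1, (phi (t1 - t)).2).
  pose psi t := (- (phi (t1 - t)).1, (phi (t1 - t)).2).
  suff : (fun t => phi (t1 + t)) = psi by move/(congr1 (fun g => g t)).
  apply: flow_unique; first by rewrite /psi !subr0 x1 oppr0 addr0 -x1 -surjective_pairing.
    exact: shift.
  move=> s; have [d1 d2] := reflect t1 s.
  have [e1 e2] := FX_evenx (phi (t1 - s)).1 (phi (t1 - s)).2.
  have -> : (FX \o psi) s = ((FX (phi (t1 - s))).1, - (FX (phi (t1 - s))).2).
    by rewrite /comp /psi [LHS]surjective_pairing e1 e2 -surjective_pairing.
  split; last exact d2.
  by have h := is_deriveN d1; rewrite opprK in h; exact h.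
move=> t.
have -> : t + 2 * (t1 - t0) = t1 + (t + t1 - 2 * t0) by ring.
rewrite refl_x (_ : t1 - (t + t1 - 2 * t0) = t0 + (t0 - t)); last by ring.
rewrite refl_y (_ : t0 - (t0 - t) = t) //=; last by ring.
Qed.

Lemma reversible_center : Defs.center X.
Proof.
split.
  rewrite /X /= expr0n /= mulr0 oppr0; congr (_, _).
  by have := f_oddy 0 0; rewrite oppr0; lra.
exists U; split; first exact: U_open.
  by split; rewrite ?normr0 //= H_0 /c0 divr_gt0 // exprn_gt0.
move=> p Up p0; have [phi [phi0 dphi]] := flow_exists p.
have U0 : U (phi 0) by rewrite phi0.
have Uphi t : U (phi t) by have [] := trapped U0 dphi t.
have x_r t : `|(phi t).1| <= r by have [/ltW] := Uphi t.
have y_r t : `|(phi t).2| <= r by have [_ /ltW] := Uphi t.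
have FXphi t : (FX \o phi) t = X (phi t) by exact: FX_box.
have dx t : is_derive t (1 : R) (fun s => (phi s).1) (f ((phi t).1, (phi t).2)).
  by have [d1 _] := dphi t; rewrite FXphi in d1; rewrite -surjective_pairing.
have dy t : is_derive t (1 : R) (fun s => (phi s).2) (- (2 * (phi t).1 ^+ 3)).
  by have [_ d2] := dphi t; rewrite FXphi in d2.
have [t0 y0] := hits_first_axis dx dy x_r y_r.
have [t1 x1] := hits_second_axis dx dy x_r y_r y0.
have turn := half_turn dphi y0 x1.
(* The orbit stays on a positive level of [H], whereas [H] is 0 at the origin. *)
have phi_neq0 t : phi t <> (0, 0).
  have [x_0 y_0 _] := Uphi t; have [_ HH] := trapped U0 dphi t.
  move=> E; have [xp yp _] := Up.
  by have := H_gt0 (ltW xp) (ltW yp) p0; rewrite -phi0 -HH E H_0 ltxx.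
have t01 : t1 - t0 != 0.
  rewrite subr_eq0; apply/eqP => E; apply: (phi_neq0 t0).
  by rewrite (surjective_pairing (phi t0)) y0 -E x1.
exists phi; split=> //; split.
- move=> t; rewrite -FXphi [(FX \o phi) t]surjective_pairing.
  by have [d1 d2] := dphi t; exact: is_derive_pairP.
- have turn2 t : phi (t + 4 * (t1 - t0)) = phi t.
    have -> : t + 4 * (t1 - t0) = t + 2 * (t1 - t0) + 2 * (t1 - t0) by ring.
    by rewrite turn turn /= !opprK -surjective_pairing.
  (* Nothing orders the two meeting instants, hence the absolute value. *)
  exists (4 * `|t1 - t0|); split; first by rewrite mulr_gt0 // normr_gt0.
  move=> t; case: (leP 0 (t1 - t0)) => h; first by rewrite ger0_norm // turn2.
  by rewrite -[LHS]turn2 ltr0_norm //; congr phi; ring.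
(* Half a turn later the orbit is at the point opposite to [phi 0], which is another point. *)
exists (0 + 2 * (t1 - t0)) => E; apply: (phi_neq0 0).
move: E; rewrite turn [in RHS](surjective_pairing (phi 0)) => -[e1 e2].
by rewrite (surjective_pairing (phi 0)); congr (_, _); lra.
Qed.

End ReversibleCenter.

(** * Sufficiency *)

Section EvenCoefficientsCenter.
Context {R : realType}.
Variables (n : nat) (a : nat -> nat -> R).
Hypothesis e_oddx : forall k l, odd k -> xdot_coef n a k l = 0.

Let e := xdot_coef n a.
(** Exceeds the degree [2 * n + 3] and is even, as the passage to squared variables requires. *)
Let D := (2 * (n + 2))%N.

Let e_even k l : e k l != 0 -> ~~ odd k && odd l.
Proof.
case: (boolP (odd k)) => [ko|ke]; first by rewrite /e e_oddx ?eqxx.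
rewrite /e /xdot_coef /=; case: ifP => [/andP[_ /eqP -> //]|_].
by case: ifP => [kl _|_]; [lia|rewrite eqxx].
Qed.

Let f (p : R * R) := \sum_(k < D) \sum_(l < D) e k l * p.1 ^+ k * p.2 ^+ l.

Let f_lip : bounded_lipschitz (f \o clip2).
Proof.
apply: (@bounded_lipschitz_sum _ D (fun k p =>
  \sum_(l < D) e k l * (clip2 p).1 ^+ k * (clip2 p).2 ^+ l)) => k.
apply: (@bounded_lipschitz_sum _ D (fun l p => e k l * (clip2 p).1 ^+ k * (clip2 p).2 ^+ l)) => l.
apply: bounded_lipschitzM; last exact: bounded_lipschitzX bounded_lipschitz_clip2.
apply: bounded_lipschitzM; first exact: bounded_lipschitz_cst.
exact: bounded_lipschitzX bounded_lipschitz_clip1.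
Qed.

Let f_evenx x y : f (- x, y) = f (x, y).
Proof.
apply: eq_bigr => k _; apply: eq_bigr => l _ /=.
have [->|/e_even/andP[ke _]] := eqVneq (e k l) 0; first by rewrite !mul0r.
by rewrite exprNn -signr_odd (negPf ke) expr0 mul1r.
Qed.

Let f_oddy x y : f (x, - y) = - f (x, y).
Proof.
rewrite /f -sumrN; apply: eq_bigr => k _; rewrite -sumrN; apply: eq_bigr => l _ /=.
have [->|/e_even/andP[_ lo]] := eqVneq (e k l) 0; first by rewrite !mul0r oppr0.
by rewrite [(- y) ^+ l]exprNn -signr_odd lo expr1 mulN1r mulrN.
Qed.

(** The quotient of [f] by [y], a polynomial since only odd powers of [y] occur; for [l = 0], where
    the predecessor is truncated, the coefficient is zero. *)
Let g (p : R * R) := \sum_(k < D) \sum_(l < D) e k l * p.1 ^+ k * p.2 ^+ l.-1.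

Let fE x y : f (x, y) = y * g (x, y).
Proof.
rewrite /f /g mulr_sumr; apply: eq_bigr => k _; rewrite mulr_sumr; apply: eq_bigr => l _ /=.
have [->|/e_even/andP[_ lo]] := eqVneq (e k l) 0; first by rewrite !mul0r mulr0.
by case: (val l) lo => // l' _; rewrite exprS /=; ring.
Qed.

Let g0 : g (0, 0) = 1.
Proof.
have D0 : (0 < D)%N by rewrite /D; lia.
have D1 : (1 < D)%N by rewrite /D; lia.
rewrite /g (bigD1 (Ordinal D0)) //= [X in _ + X]big1 ?addr0; last first.
  move=> k k0; rewrite big1 // => l _; rewrite expr0n.
  have -> : (val k == 0)%N = false by apply: contraNF k0 => /eqP k0; apply/eqP/val_inj.
  by rewrite mulr0 mul0r.
rewrite (bigD1 (Ordinal D1)) //= big1 ?addr0; first by rewrite /e /xdot_coef /= !mulr1.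
move=> l l1; have [->|/e_even/andP[_ lo]] := eqVneq (e 0%N l) 0; first by rewrite !mul0r.
rewrite [0 ^+ l.-1]expr0n; have -> : (l.-1 == 0)%N = false; last by rewrite mulr0.
apply: contraNF l1 => /eqP l1; apply/eqP/val_inj => /=.
by case: (val l) l1 lo => [|[|l']].
Qed.

Let g_near : \forall p \near ((0, 0) : R * R), 2^-1 <= g p.
Proof.
have [K [K0 _ gL]] : bounded_lipschitz (g \o clip2).
  apply: (@bounded_lipschitz_sum _ D (fun k p =>
    \sum_(l < D) e k l * (clip2 p).1 ^+ k * (clip2 p).2 ^+ l.-1)) => k.
  apply: (@bounded_lipschitz_sum _ D (fun l p => e k l * (clip2 p).1 ^+ k * (clip2 p).2 ^+ l.-1)) => l.
  apply: bounded_lipschitzM; last exact: bounded_lipschitzX bounded_lipschitz_clip2.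
  apply: bounded_lipschitzM; first exact: bounded_lipschitz_cst.
  exact: bounded_lipschitzX bounded_lipschitz_clip1.
have K1 : 0 < K + 1 by lra.
have d0 : 0 < (2 * (K + 1))^-1 by rewrite invr_gt0 mulr_gt0.
apply/near0_boxP; exists (Num.min 1 (2 * (K + 1))^-1); first by rewrite lt_min ltr01.
move=> x y; rewrite !lt_min => /andP[x1 xK] /andP[y1 yK].
have cxy : clip2 (x, y) = (x, y) by rewrite /clip2 /= !clip_id // ltW.
have c00 : clip2 (0, 0) = (0, 0) :> R * R by rewrite /clip2 /= clip_id ?normr0.
have := gL (x, y) (0, 0); rewrite /comp cxy c00 g0.
have md : maxdist (x, y) (0, 0) <= (2 * (K + 1))^-1.
  by rewrite maxdist_le /= !subr0 !ltW.
have : K * maxdist (x, y) (0, 0) <= 2^-1.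
  apply: (@le_trans _ _ ((K + 1) * (2 * (K + 1))^-1)).
    by apply: ler_pM => //; [exact: maxdist_ge0|lra].
  by rewrite invfM mulrCA divff ?mulr1 // gt_eqF.
by rewrite ler_norml => h1 /andP[h2 h3]; lra.
Qed.

Lemma even_coef_analytic_center : (0 < n)%N -> analytic_center (nilpotent_system n a).
Proof.
move=> n0; have nD : (2 * n + 3 < D)%N by rewrite /D; lia.
have XE : nilpotent_system n a = fun p => (f p, - (2 * p.1 ^+ 3)).
  by apply/funext => p; exact: nilpotent_systemE.
have e01 : e 0%N 1%N = 1 by [].
have n2 : (0 < n + 2)%N by lia.
have [c [gc lc0 c0q c13 c40]] := even_first_integral_coef n2 e01 e_even.
have pde : \forall p \near ((0, 0) : R * R),
    f p * 'D_((1, 0) : R * R) (pseries2 c) p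
    - 2 * p.1 ^+ 3 * 'D_((0, 1) : R * R) (pseries2 c) p = 0.
  have := near_pseries2_lie D e gc.
  have -> : lie_coef D e c = fun _ _ => 0 by apply/funext => i; apply/funext => j; exact: lc0.
  by apply: filterS => p; rewrite pseries2_0 => /esym.
have H_diff := near_pseries2_is_diff gc.
split; last first.
  exists (pseries2 c); split.
  - exact: near_pseries2_analytic.
  - by apply: filterS pde => p; rewrite XE /= mulNr.
  (* The coefficient 1 of [y ^+ 2] excludes a locally constant series. *)
  rewrite pseries2_origin c0q => H0.
  by have := pseries2_identity gc H0 0 2; rewrite c0q => /eqP; rewrite oner_eq0.
(* Factoring [x ^+ 4] out of [H - y ^+ 2] leaves a series with value 1 at the origin, hence above
   1/2 nearby: this yields the lower bound [y ^+ 2 + x ^+ 4 / 2] of [H]. *)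
pose c4 i j := c (i + 4)%N j.
have gc4 : geo_bounded c4.
  have [C [M [C0 M1 cM]]] := gc; exists (C * M ^+ 4), M; split => // [|i j].
    by rewrite mulr_ge0 // exprn_ge0 //; lra.
  rewrite /c4 (le_trans (cM _ _)) // -mulrA -exprD le_eqVlt; apply/predU1P; left.
  by congr (_ * _ ^+ _); lia.
have H_split : \forall p \near ((0, 0) : R * R),
    pseries2 c p = p.2 ^+ 2 + p.1 ^+ 4 * pseries2 c4 p.
  pose u : nat -> nat -> R := fun i j => if (i == 0)%N && (j == 0)%N then 1 else 0.
  have gu : geo_bounded u by exact: geo_bounded_const.
  have cE : c = fun i j => shift_coef 0 2 u i j + shift_coef 4 0 c4 i j.
    apply/funext => i; apply/funext => j; rewrite /shift_coef /u /c4 !subn0 /= andbT.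
    case: i => [|[|[|[|i]]]] /=.
    - rewrite c0q addr0; case: j => [|[|[|j]]] //=.
    - by rewrite c13 ?addr0 //; case: ifP.
    - by rewrite c13 ?addr0 //; case: ifP.
    - by rewrite c13 ?addr0 //; case: ifP.
    by rewrite subnK //=; case: ifP; rewrite add0r.
  have su := near_abs_summable gu; have s4 := near_abs_summable gc4.
  apply: filterS2 su s4 => p su s4.
  rewrite {1}cE pseries2D; try exact: abs_summable_shift.
  by rewrite !pseries2_shift // pseries2_const !expr0 mulr1 mul1r mulr1.
have c4_near : \forall p \near ((0, 0) : R * R), 2^-1 < pseries2 c4 p.
  have [d _] := nbhs_singleton (near_pseries2_is_diff gc4).
  have c4c := differentiable_continuous d.
  apply: (cvgr_gt _ c4c); rewrite pseries2_origin /c4 c40; lra.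
have [r1 r10 Hr1] := (near0_boxP _).1 H_diff.
have [r2 r20 Hr2] := (near0_boxP _).1 pde.
have [r3 r30 Hr3] := (near0_boxP _).1 H_split.
have [r4 r40 Hr4] := (near0_boxP _).1 c4_near.
have [r5 r50 Hr5] := (near0_boxP _).1 g_near.
(* Halving turns the closed box of size [r] into a part of all the open ones; the entry 1 ensures
   [r <= 2^-1]. *)
pose r := Num.min (Num.min r1 (Num.min r2 r3)) (Num.min r4 (Num.min r5 1)) / 2.
have r0 : 0 < r by rewrite divr_gt0 // !lt_min r10 r20 r30 r40 r50 ltr01.
have rr z : `|z| <= r -> [/\ `|z| < r1, `|z| < r2, `|z| < r3, `|z| < r4 & `|z| < r5].
  move=> zr; have : `|z| < 2 * r by lra.
  rewrite /r mulrC divfK ?pnatr_eq0 // !lt_min.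
  by move=> /and3P[/and3P[? ? ?] ? /andP[? ?]].
rewrite XE.
apply: (@reversible_center _ f (pseries2 c) (pseries2 (dx c)) (pseries2 (dy c)) r) => //.
- rewrite /r ler_pdivrMr // mulVf ?pnatr_eq0 //.
  by rewrite !ge_min lexx !orbT.
- move=> x y /rr[_ _ _ _ x5] /rr[_ _ _ _ y5] y0.
  by rewrite fE; apply: ler_wpM2l; [exact: ltW|exact: Hr5].
- by move=> [x y] /= /rr[x1 _ _ _ _] /rr[y1 _ _ _ _]; exact: Hr1.
- move=> [x y] /= /rr[x1 x2 _ _ _] /rr[y1 y2 _ _ _].
  have := Hr2 _ _ x2 y2; have [-> ->] := is_diff_derive (Hr1 _ _ x1 y1).
  by [].
- move=> x y /rr[_ _ x3 x4 _] /rr[_ _ y3 y4 _].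
  rewrite (Hr3 _ _ x3 y3) /= lerD2l ler_wpM2l ?exprn_even_ge0 // ltW //.
  exact: Hr4.
by rewrite pseries2_origin c0q.
Qed.

End EvenCoefficientsCenter.

Theorem theorem3p5 (R : realType) (n : nat) (hn : (2 <= n)%N)
    (a : nat -> nat -> R) :
  analytic_center (nilpotent_system n a) <->
  (a 3%N 0%N = 0 /\ a 1%N 2%N = 0 /\
   forall k : nat, (k <= n + 1)%N -> a (2 * n + 3 - 2 * k)%N (2 * k)%N = 0).
Proof.
rewrite -odd_xdot_coef0 //; split=> [[_ [H firstH]]|e_oddx].
  exact: analytic_first_integral_coef firstH.
by apply: even_coef_analytic_center => //; exact: ltnW.
Qed.
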